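(* Let $A\in\mathbb{R}^{m_1\times n_1}$, $a\in\mathbb{R}^{1\times n_1}$ with $a\neq 0$, $b\in\mathbb{R}^{1\times n_2}$ with $b\neq 0$, $B\in\mathbb{R}^{m_2\times n_2}$, $c_A\in\mathbb{R}^{m_1}$, $c_B\in\mathbb{R}^{m_2}$ and $c\in\mathbb{R}$. Consider the ($2$-sum) polyhedron \[ R=\{(x,y)\in\mathbb{R}^{n_1}\times\mathbb{R}^{n_2} : Ax=c_A,\ ax+by=c,\ By=c_B,\ x\ge 0,\ y\ge 0\}. \] Let $\bar A=\begin{bmatrix}A\\ a\end{bmatrix}$ and $\bar B=\begin{bmatrix}b\\ B\end{bmatrix}$. Then the combinatorial diameter of $R$ satisfies \[ d(R)\le d(A)\,(d(\bar A)+1)+d(B)\,(d(\bar B)+1)+\min\{d(\bar A)+d(B)+1,\ d(A)+d(\bar B)+1\}. \]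
   Context: The distance $d_P(v,w)$ between two vertices of a polyhedron $P$ is the minimum number of edges in an edge walk from $v$ to $w$ in the graph of $P$; the (combinatorial) diameter $d(P)$ is the maximum of $d_P(v,w)$ over all pairs of vertices. For a matrix $M\in\mathbb{R}^{m\times n}$, $d(M):=\max\{d(\{x: Mx=r,\ x\ge 0\}) : r\in\mathbb{R}^m\}$, i.e., the largest diameter of any standard-form polyhedron with equality constraint matrix $M$. *)

(* Defs.v *)
From HB Require Import structures.
From mathcomp Require Import all_boot all_order all_algebra.
From mathcomp Require Import reals.
Set Implicit Arguments. Unset Strict Implicit. Unset Printing Implicit Defensive.
Import Order.TTheory GRing.Theory Num.Theory.
Local Open Scope ring_scope.

Section Polyhedra.
Variable R : realType.

Definition pset (n : nat) := 'cV[R]_n -> Prop.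

Definition valid_ineq n (P : pset n) (c : 'rV[R]_n) (delta : R) :=
  forall x, P x -> (c *m x) 0 0 <= delta.

Definition is_vertex n (P : pset n) (v : 'cV[R]_n) :=
  exists (c : 'rV[R]_n) (delta : R), valid_ineq P c delta /\
    forall x, (P x /\ (c *m x) 0 0 = delta) <-> x = v.

Definition segment n (v w : 'cV[R]_n) (x : 'cV[R]_n) :=
  exists t : R, 0 <= t /\ t <= 1 /\ x = t *: v + (1 - t) *: w.

Definition adjacent n (P : pset n) (v w : 'cV[R]_n) :=
  is_vertex P v /\ is_vertex P w /\ v <> w /\
  exists (c : 'rV[R]_n) (delta : R), valid_ineq P c delta /\
    forall x, (P x /\ (c *m x) 0 0 = delta) <-> segment v w x.

Fixpoint dist_le n (P : pset n) (k : nat) (v w : 'cV[R]_n) : Prop :=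
  v = w \/ match k with
           | 0 => False
           | k'.+1 => exists u, adjacent P v u /\ dist_le P k' u w
           end.

Definition diam_le n (P : pset n) (k : nat) :=
  forall v w, is_vertex P v -> is_vertex P w -> dist_le P k v w.

Definition stdpoly m n (M : 'M[R]_(m, n)) (r : 'cV[R]_m) : pset n :=
  fun x => M *m x = r /\ forall i, 0 <= x i 0.

Definition mxdiam_le m n (M : 'M[R]_(m, n)) (k : nat) :=
  forall r : 'cV[R]_m, diam_le (stdpoly M r) k.

Definition twosum m1 n1 m2 n2 (A : 'M[R]_(m1, n1)) (a : 'rV[R]_n1)
  (b : 'rV[R]_n2) (B : 'M[R]_(m2, n2)) (cA : 'cV[R]_m1) (cB : 'cV[R]_m2)
  (c : R) : pset (n1 + n2) :=
  fun z => let x := usubmx z in let y := dsubmx z in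
    [/\ A *m x = cA, a *m x + b *m y = c%:M, B *m y = cB,
        forall i, 0 <= x i 0 & forall j, 0 <= y j 0].

End Polyhedra.

(* Main.v *)
Require Import Defs.
From HB Require Import structures.
From mathcomp Require Import all_boot all_order all_algebra.
From mathcomp Require Import reals.
From mathcomp Require Import boolp ring lra zify.
Set Implicit Arguments. Unset Strict Implicit. Unset Printing Implicit Defensive.
Import Order.TTheory GRing.Theory Num.Theory.
Local Open Scope ring_scope.

(** A vertex (x, y) of the 2-sum has x and y vertices of their slices
    {A x = c_A, a x = t} and {B y = c_B, b y = c - t}, and at least one of them a
    vertex of {A x = c_A, x >= 0} or {B y = c_B, y >= 0}; the other one then lies
    on an edge. Choose edge walks from x1 to x2 and from y1 to y2 and move both
    points along them, keeping a x + b y = c: one step of the 2-sum moves both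
    until one of them reaches a vertex of its polyhedron. While y is a vertex, x
    may jump to a later point of its walk at the same level, at the cost of a
    walk inside a slice, and symmetrically for y. Turning points of the level are
    always handled by such a jump, so each jump and each step can be charged to a
    new edge of one of the two walks, which gives at most
    d(A) (d(A-bar) + 1) + d(B) (d(B-bar) + 1) + 1 steps. If x1 and x2 both lie
    inside edges, then first x slides along its edge while y walks; in that case
    one uses that the slices have diameter at most 1 when d(A) = 0. *)

(** * Supports and ratio tests in the nonnegative orthant *)

Section Support.
Variables (R : realType) (n : nat).
Implicit Types (x y z v w : 'cV[R]_n).

Definition nonneg x := forall i, 0 <= x i 0.
(** Support inclusion. It singles out the directions along which a nonnegative [x] can be moved a
    little both ways. *)
Definition ssub z x := forall i, x i 0 = 0 -> z i 0 = 0.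

Lemma colP0 x y : (forall i, x i 0 = y i 0) -> x = y.
Proof. by move=> h; apply/colP. Qed.

Definition lev (c : 'rV[R]_n) x : R := (c *m x) 0 0.

Lemma levD c x y : lev c (x + y) = lev c x + lev c y.
Proof. by rewrite /lev mulmxDr mxE. Qed.

Lemma levZ c t x : lev c (t *: x) = t * lev c x.
Proof. by rewrite /lev -scalemxAr mxE. Qed.

Lemma levB c x y : lev c (x - y) = lev c x - lev c y.
Proof. by rewrite levD -scaleN1r levZ mulN1r. Qed.

Lemma nonzero_entry x : x <> 0 -> exists i, x i 0 != 0.
Proof.
move=> nz; apply: contrapT => h; apply: nz; apply: colP0 => i; rewrite mxE.
by apply/eqP/negPn/negP => xi; apply: h; exists i.
Qed.

Lemma perturb v z : nonneg v -> ssub z v ->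
  exists2 e : R, 0 < e & nonneg (v + e *: z) /\ nonneg (v - e *: z).
Proof.
move=> v0 zv.
(* [S] dominates every ratio of entries; where [v i 0 = 0] the quotient is 0 by convention. *)
pose S := \sum_(i < n) `|z i 0| / v i 0.
have S0 : 0 <= S by apply: sumr_ge0 => i _; apply: divr_ge0.
exists (1 + S)^-1; first by rewrite invr_gt0; lra.
have key i : `|(1 + S)^-1 * z i 0| <= v i 0.
  rewrite normrM ger0_norm ?invr_ge0; last by lra.
  rewrite mulrC ler_pdivrMr; last by lra.
  have [vi|vi] := eqVneq (v i 0) 0; first by rewrite (zv _ vi) normr0 vi mul0r.
  have vi0 : 0 < v i 0 by rewrite lt_neqAle eq_sym vi /=.
  have : `|z i 0| / v i 0 <= S.
    rewrite /S (bigD1 i) //= lerDl; apply: sumr_ge0 => j _; exact: divr_ge0.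
  by rewrite ler_pdivrMr // => h; nra.
by split=> i; have := key i; rewrite !mxE ler_norml => /andP[]; lra.
Qed.

(** The minimum ratio test: [i] is a coordinate that blocks first on the way from [y] to [z]. *)
Lemma ray_exit y z : nonneg y -> ~ nonneg z ->
  exists t i, [/\ 0 <= t, t < 1, nonneg (y + t *: (z - y)),
                  (y + t *: (z - y)) i 0 = 0 & z i 0 < 0].
Proof.
move=> y0 /existsNP[i0 /negP]; rewrite -ltNge => zi0.
case: (@Order.TotalTheory.arg_minP _ R _ i0 (fun i => z i 0 < 0)
  (fun i => y i 0 / (y i 0 - z i 0)) zi0) => i zi imin.
set t := y i 0 / (y i 0 - z i 0) in imin.
have yi := y0 i.
have t0 : 0 <= t by apply: divr_ge0 => //; lra.
have t1 : t < 1 by rewrite ltr_pdivrMr; lra.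
exists t, i; split=> //; last first.
  by rewrite !mxE /t; field; apply/eqP; lra.
move=> j; rewrite !mxE; have yj := y0 j.
have [zj|zj] := ltP (z j 0) 0; last by nra.
have := imin j zj; rewrite ler_pdivlMr; last by lra.
by nra.
Qed.

Lemma boundary_step x d : nonneg x -> d <> 0 -> ssub d x ->
  exists k j, [/\ nonneg (x + k *: d), x j 0 <> 0, d j 0 <> 0 &
                  (x + k *: d) j 0 = 0].
Proof.
move=> x0 dnz dx; have [i di] := nonzero_entry dnz.
(* This multiple makes coordinate [i] equal to -1, so the ray must leave the orthant. *)
pose N := - (x i 0 + 1) / d i 0.
have /(ray_exit x0)[t [j [t0 t1 h hj zj]]] : ~ nonneg (x + N *: d).
  by move=> /(_ i); rewrite !mxE /N divfK //; lra.
exists (t * N), j; have e : x + (t * N) *: d = x + t *: (x + N *: d - x).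
  by rewrite [x + N *: d]addrC addrK scalerA.
rewrite e; split=> // hz; move: zj; rewrite !mxE ?hz.
  by rewrite dx // mulr0 addr0 ltxx.
by have := x0 j; rewrite mulr0 addr0; lra.
Qed.

End Support.

(** * Vertices and adjacency in terms of kernel directions *)

Section Characterization.
Variables (R : realType) (n : nat) (P : pset R n) (K : 'cV[R]_n -> Prop).
Implicit Types (x y z v w : 'cV[R]_n).
(** These hypotheses abstract an affine subspace with directions [K], cut with the orthant; they are
    instantiated for [stdpoly] and for [twosum]. *)
Hypothesis KZ : forall t z, K z -> K (t *: z).
Hypothesis P_nonneg : forall x, P x -> nonneg x.
Hypothesis P_move : forall x z, P x -> K z -> nonneg (x + z) -> P (x + z).
Hypothesis P_diff : forall x y, P x -> P y -> K (y - x).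

(** Both [v + e *: z] and [v - e *: z] lie in [P], so a functional maximal at [v] is constant along
    [z]. *)
Lemma face_perturb c delta v z : valid_ineq P c delta -> P v ->
  (c *m v) 0 0 = delta -> K z -> ssub z v ->
  exists2 e : R, 0 < e & P (v + e *: z) /\ (c *m (v + e *: z)) 0 0 = delta.
Proof.
move=> ok Pv cv Kz zv.
have [e e0 [h1 h2]] := perturb (P_nonneg Pv) zv; exists e => //.
have P1 := P_move Pv (KZ e Kz) h1.
have P2 : P (v - e *: z).
  by rewrite -scaleNr; apply: P_move => //; [exact: KZ | rewrite scaleNr].
split=> //; have p1 : lev c _ <= delta := ok _ P1.
have p2 : lev c _ <= delta := ok _ P2.
by move: cv p1 p2; rewrite -/(lev c v) -/(lev c (v + e *: z)) levB levD levZ; lra.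
Qed.

(** For [u] in [P] this functional exposes the smallest face containing [u]. Taking [v + w] for [u]
    gives the face of the midpoint, which has the same zeros. *)
Definition face_row (u : 'cV[R]_n) : 'rV[R]_n := \row_i - (u i 0 == 0)%:R.

Lemma face_row_valid u : valid_ineq P (face_row u) 0.
Proof.
move=> x /P_nonneg x0; rewrite mxE; apply: sumr_le0 => i _; rewrite mxE.
by have := x0 i; case: (_ == _) => /=; lra.
Qed.

Lemma face_rowE u x : P x -> ((face_row u) *m x) 0 0 = 0 <-> ssub x u.
Proof.
move=> Px; have x0 := P_nonneg Px; rewrite mxE.
have -> : \sum_j face_row u 0 j * x j 0 = - \sum_j (u j 0 == 0)%:R * x j 0.
  by rewrite -sumrN; apply: eq_bigr => i _; rewrite mxE mulNr.
split=> [/eqP|h].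
  rewrite oppr_eq0 psumr_eq0 => [/allP h i ui|i _]; last exact: mulr_ge0.
  by have := h i (mem_index_enum _); rewrite /= ui eqxx mul1r => /eqP.
rewrite big1 ?oppr0 // => i _; have [ui|] := eqVneq (u i 0) 0; last by rewrite mul0r.
by rewrite h ?mulr0.
Qed.

Lemma vertex_kerP v :
  is_vertex P v <-> P v /\ (forall z, K z -> ssub z v -> z = 0).
Proof.
split=> [[c [delta [ok hv]]]|[Pv h]].
  have [Pv cv] := (hv v).2 erefl; split=> // z Kz zv.
  have [e e0 /hv/eqP] := face_perturb ok Pv cv Kz zv.
  by rewrite -subr_eq0 addrC addKr scaler_eq0 gt_eqF //= => /eqP.
exists (face_row v), 0; split; first exact: face_row_valid.
move=> x; split=> [[Px /face_rowE-/(_ Px) xv]|->].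
  apply/eqP; rewrite -subr_eq0; apply/eqP; apply: h; first exact: P_diff.
  by move=> i vi; rewrite !mxE vi xv // subrr.
by split=> //; apply/face_rowE.
Qed.

Lemma adjacent_kerP v w :
  adjacent P v w <-> [/\ is_vertex P v, is_vertex P w, v <> w &
    forall z, K z -> ssub z (v + w) -> exists k, z = k *: (w - v)].
Proof.
split=> [[vv [vw [nvw [c [delta [ok hs]]]]]]|[vv vw nvw h]].
  split=> // z Kz zvw; pose m := 2^-1 *: v + (1 - 2^-1) *: w.
  have /hs[Pm cm] : segment v w m by exists 2^-1; split; [lra | split; [lra|]].
  have zm : ssub z m.
    move=> i mi; apply: zvw; move: mi; rewrite !mxE; lra.
  have [e e0 /hs[t [_ [_ E]]]] := face_perturb ok Pm cm Kz zm.
  exists ((2^-1 - t) / e); apply: colP0 => i.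
  have := congr1 (fun f : 'cV_n => f i 0) E; rewrite !mxE => E'.
  have e1 : e != 0 by rewrite gt_eqF.
  apply: (mulfI e1).
  have -> : e * ((2^-1 - t) / e * (w i 0 - v i 0)) = (2^-1 - t) * (w i 0 - v i 0).
    by field.
  lra.
have [Pv hv] := (vertex_kerP v).1 vv; have [Pw hw] := (vertex_kerP w).1 vw.
have v0 := P_nonneg Pv; have w0 := P_nonneg Pw.
split=> //; split=> //; split=> //; exists (face_row (v + w)), 0.
split; first exact: face_row_valid.
move=> x; split=> [[Px /face_rowE-/(_ Px) xv]|[t [t0 [t1 ->]]]].
  have x0 := P_nonneg Px.
  have [k Ek] : exists k, x - v = k *: (w - v).
    apply: h; first exact: P_diff.
    move=> i vi; have := xv _ vi; move: vi; rewrite !mxE.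
    by have := v0 i; have := w0 i; lra.
  have Ei i : x i 0 - v i 0 = k * (w i 0 - v i 0).
    by have := congr1 (fun f : 'cV_n => f i 0) Ek; rewrite !mxE.
  exists (1 - k).
  (* Otherwise [w] lies strictly between [v] and [x], so [v - w] is a direction supported in the
     vertex [w]. The bound [0 <= k] is the same at [v]. *)
  have k1 : k <= 1.
    rewrite leNgt; apply/negP => k1; case: nvw; apply/esym/eqP.
    rewrite -subr_eq0 -oppr_eq0 opprB; apply/eqP; apply: hw; first exact: P_diff.
    move=> i wi; have := Ei i; have := x0 i; have := v0 i.
    by rewrite !mxE wi; nra.
  have k0 : 0 <= k.
    rewrite leNgt; apply/negP => k0; case: nvw; apply/esym/eqP.
    rewrite -subr_eq0; apply/eqP; apply: hv; first exact: P_diff.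
    move=> i vi; have := Ei i; have := x0 i; have := w0 i.
    by rewrite !mxE vi; nra.
  split; [lra|split; [lra|]].
  by apply: colP0 => i; rewrite !mxE; have := Ei i; lra.
have E : t *: v + (1 - t) *: w = v + (1 - t) *: (w - v).
  by apply: colP0 => i; rewrite !mxE; ring.
have Px : P (t *: v + (1 - t) *: w).
  rewrite E; apply: P_move => //; first by apply: KZ; exact: P_diff.
  by move=> i; rewrite -E !mxE; have := v0 i; have := w0 i; nra.
split=> //; apply/face_rowE => //.
move=> i vi; move: vi; rewrite !mxE => vi.
have [-> ->] : v i 0 = 0 /\ w i 0 = 0 by have := v0 i; have := w0 i; split; lra.
by rewrite !mulr0 addr0.
Qed.

End Characterization.

(** * Edges of a standard-form polyhedron and their levels *)

Section Edges.
Variables (R : realType) (m n : nat) (A : 'M[R]_(m, n)) (a : 'rV[R]_n).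
Variable r : 'cV[R]_m.
Implicit Types (p q x y z : 'cV[R]_n).

Definition vert x :=
  stdpoly A r x /\ forall z, A *m z = 0 -> ssub z x -> z = 0.
(* Vertices of the slice of the polyhedron at the level of [x]. *)
Definition svert x := stdpoly A r x /\
  forall z, A *m z = 0 -> lev a z = 0 -> ssub z x -> z = 0.
(* [p] and [q] span a one-dimensional face; they need not be its endpoints. *)
Definition edge p q := [/\ stdpoly A r p, stdpoly A r q, p <> q &
  forall z, A *m z = 0 -> ssub z (p + q) -> exists k, z = k *: (q - p)].
(** The whole line: [p] and [q] need not be the ends of the face, and points outside the polyhedron
    occur as targets. *)
Definition online p q x := exists t, x = p + t *: (q - p).

Lemma stdpoly_ker x y : stdpoly A r x -> stdpoly A r y -> A *m (y - x) = 0.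
Proof. by move=> [Ax _] [Ay _]; rewrite mulmxBr Ax Ay subrr. Qed.

Lemma ker_scale t z : A *m z = 0 -> A *m (t *: z) = 0.
Proof. by move=> h; rewrite -scalemxAr h scaler0. Qed.

Lemma is_vertexE x : is_vertex (stdpoly A r) x <-> vert x.
Proof.
apply: (vertex_kerP (K := fun z => A *m z = 0)).
- exact: ker_scale.
- by move=> {}x [].
- by move=> {}x z [Ax _] Az xz; split=> //; rewrite mulmxDr Ax Az addr0.
- exact: stdpoly_ker.
Qed.

Lemma adjacentE x y : adjacent (stdpoly A r) x y <->
  [/\ vert x, vert y, x <> y &
      forall z, A *m z = 0 -> ssub z (x + y) -> exists k, z = k *: (y - x)].
Proof.
have H : adjacent (stdpoly A r) x y <-> [/\ is_vertex (stdpoly A r) x,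
    is_vertex (stdpoly A r) y, x <> y &
    forall z, A *m z = 0 -> ssub z (x + y) -> exists k, z = k *: (y - x)].
  apply: (adjacent_kerP (K := fun z => A *m z = 0)).
  - exact: ker_scale.
  - by move=> {}x [].
  - by move=> {}x z [Ax _] Az xz; split=> //; rewrite mulmxDr Ax Az addr0.
  - exact: stdpoly_ker.
by rewrite H; split=> -[/is_vertexE ? /is_vertexE ?]; split.
Qed.

Lemma adjacent_edge x y : adjacent (stdpoly A r) x y -> edge x y.
Proof. by move=> /adjacentE[[Px _] [Py _] nxy h]. Qed.

Lemma edge_sym p q : edge p q -> edge q p.
Proof.
move=> [Pp Pq npq h]; split=> //; first by move=> e; apply: npq.
move=> z Az zs; have [k ->] := h z Az ltac:(by rewrite addrC).
by exists (- k); rewrite -opprB scaleNr scalerN.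
Qed.

Lemma vert_svert x : vert x -> svert x.
Proof. by move=> [Px h]; split=> // z Az _; apply: h. Qed.

Lemma online_l p q : online p q p.
Proof. by exists 0; rewrite scale0r addr0. Qed.

Lemma online_r p q : online p q q.
Proof. by exists 1; rewrite scale1r addrC subrK. Qed.

Lemma lev_online p q t : lev a (p + t *: (q - p)) = lev a p + t * (lev a q - lev a p).
Proof. by rewrite levD levZ levB. Qed.

Lemma online_ker p q x : stdpoly A r p -> stdpoly A r q -> online p q x -> A *m x = r.
Proof.
move=> Pp Pq [t ->].
by rewrite mulmxDr (ker_scale t (stdpoly_ker Pp Pq)) addr0; case: Pp.
Qed.

Lemma online_uniq p q x y : lev a p != lev a q ->
  online p q x -> online p q y -> lev a x = lev a y -> x = y.
Proof.
move=> npq [t ->] [u ->]; rewrite !lev_online => /addrI/mulIf-> //.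
by rewrite subr_eq0 eq_sym.
Qed.

Lemma line_point p q h : lev a p != lev a q -> exists2 x, online p q x & lev a x = h.
Proof.
move=> npq; exists (p + ((h - lev a p) / (lev a q - lev a p)) *: (q - p)).
  by exists ((h - lev a p) / (lev a q - lev a p)).
rewrite lev_online divfK; first by rewrite addrC subrK.
by rewrite subr_eq0 eq_sym.
Qed.

Lemma online_flat p q x : online p q x -> lev a p = lev a q -> lev a x = lev a p.
Proof. by move=> [t ->] e; rewrite lev_online e; ring. Qed.

Lemma ssub_online p q x z : stdpoly A r p -> stdpoly A r q -> online p q x ->
  ssub z x -> ssub z (p + q).
Proof.
move=> [_ p0] [_ q0] [t ->] h i; rewrite !mxE => e; apply: h; rewrite !mxE.
have := p0 i; have := q0 i => ? ?.
have [-> ->] : p i 0 = 0 /\ q i 0 = 0 by split; lra.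
by ring.
Qed.

Lemma ssub_online2 p q x y z : stdpoly A r p -> stdpoly A r q ->
  stdpoly A r x -> stdpoly A r y -> online p q x -> online p q y ->
  ssub z (x + y) -> ssub z (p + q).
Proof.
move=> Pp Pq [_ x0] [_ y0] ox oy h i.
have : ssub x (p + q) by apply: (ssub_online Pp Pq ox).
have : ssub y (p + q) by apply: (ssub_online Pp Pq oy).
by move=> hy hx pq; apply: h; rewrite mxE hx ?hy ?addr0.
Qed.

(** The nonpositive product encodes that the level of [z] is between those of [x] and [y], as
    everywhere below; levels are injective on this line. *)
Lemma between_nonneg p q x y z : lev a p != lev a q ->
  online p q x -> online p q y -> online p q z -> nonneg x -> nonneg y ->
  (lev a z - lev a x) * (lev a z - lev a y) <= 0 -> nonneg z.
Proof.
move=> npq [s ->] [t ->] [u ->] hx hy; rewrite !lev_online => hh i.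
have : (u - s) * (u - t) <= 0.
  have c0 : 0 < (lev a q - lev a p) ^+ 2.
    by rewrite lt_neqAle sqr_ge0 eq_sym expf_neq0 // subr_eq0 eq_sym.
  by rewrite -(pmulr_rle0 _ c0); move: hh; congr (_ <= _); ring.
have := hx i; have := hy i; rewrite !mxE.
set d := q i 0 - p i 0; set b := p i 0 => h1 h2 h3.
have [us|us] := leP s u.
  have [ut|ut] := leP u t; first by have [d0|d0] := leP 0 d; nra.
  have -> : u = s by nra.
  by [].
have [ut|ut] := leP t u; first by have [d0|d0] := leP 0 d; nra.
by nra.
Qed.

(** The only direction available in the edge is [q - p], and it changes the level. *)
Lemma edge_svert p q x : edge p q -> lev a p != lev a q -> online p q x ->
  nonneg x -> svert x.
Proof.
move=> [Pp Pq _ h] npq ox x0; split; first by split=> //; exact: online_ker ox.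
move=> z Az lz zx; have [k E] := h z Az (ssub_online Pp Pq ox zx).
move: lz; rewrite E levZ levB => /eqP; rewrite mulf_eq0 subr_eq0.
by rewrite [lev a q == _]eq_sym (negbTE npq) orbF => /eqP->; rewrite scale0r.
Qed.

(** All directions available in a level edge keep the level, so the slice already excludes them. *)
Lemma flat_vert p q x : edge p q -> lev a p = lev a q -> online p q x ->
  svert x -> vert x.
Proof.
move=> [Pp Pq _ h] epq ox [Px hx]; split=> // z Az zx; apply: hx => //.
have [k ->] := h z Az (ssub_online Pp Pq ox zx).
by rewrite levZ levB epq subrr mulr0.
Qed.

(** If the point at level [h] is outside, the blocking coordinate of [ray_exit] vanishes at [w] and
    is not constant on the line. This makes [w] a vertex and puts the whole edge on the side of [w]
    away from [h], which is the last clause. *)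
Lemma edge_exit p q y h : edge p q -> lev a p != lev a q -> online p q y ->
  stdpoly A r y ->
  (exists x, [/\ online p q x, stdpoly A r x & lev a x = h]) \/
  exists w, [/\ online p q w, vert w,
    (lev a w - lev a y) * (lev a w - h) <= 0, lev a w != h &
    forall g, online p q g -> nonneg g ->
      (lev a g - lev a w) * (h - lev a w) <= 0].
Proof.
move=> [Pp Pq npq hker] nl oy [Ay y0].
have [z oz lz] := line_point h nl.
have [z0|/(ray_exit y0)[t [i [t0 t1 w0 wi zi]]]] := EM (nonneg z).
  by left; exists z; split=> //; split=> //; exact: online_ker oz.
right; set w := y + t *: (z - y) in w0 wi *.
have ow : online p q w.
  case: oy oz => [s Ey] [u Ez]; exists (s + t * (u - s)).
  by apply: colP0 => j; rewrite /w Ey Ez !mxE; ring.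
have lw : lev a w = lev a y + t * (h - lev a y) by rewrite /w lev_online lz.
have nw : lev a w != h.
  rewrite -lz; apply/eqP => e; have E := online_uniq nl ow oz e.
  by move: zi; rewrite -E wi ltxx.
exists w; split=> //.
- split; first by split=> //; exact: online_ker ow.
  move=> x Ax xw; have [k Ek] := hker x Ax (ssub_online Pp Pq ow xw).
  have : k * (q i 0 - p i 0) = 0.
    by rewrite -(xw i wi) Ek !mxE.
  move=> /eqP; rewrite mulf_eq0 => /orP[/eqP k0|/eqP d0].
    by rewrite Ek k0 scale0r.
  case: ow oz wi zi => [s ->] [u ->]; rewrite !mxE d0 !mulr0 !addr0 => ->.
  by rewrite ltxx.
- have -> : (lev a w - lev a y) * (lev a w - h) = - (t * (1 - t) * (lev a y - h) ^+ 2).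
    by rewrite lw; ring.
  by rewrite oppr_le0 mulr_ge0 ?sqr_ge0 // mulr_ge0 // subr_ge0 ltW.
- move=> g og g0; rewrite leNgt; apply/negP => pos.
  have hw0 : h - lev a w != 0 by rewrite subr_eq0 eq_sym.
  (* The parameter of [g] on the ray from [w] to [z]; if positive, the blocking coordinate of [g] is
     negative. *)
  pose kk := (lev a g - lev a w) / (h - lev a w).
  have kk0 : 0 < kk.
    have -> : kk = ((lev a g - lev a w) * (h - lev a w)) / (h - lev a w) ^+ 2.
      by rewrite /kk; field.
    by rewrite divr_gt0 // lt_neqAle sqr_ge0 eq_sym expf_neq0.
  have Eg : g = w + kk *: (z - w).
    apply: (online_uniq nl og).
      case: ow oz => [s ->] [u ->]; exists (s + kk * (u - s)).
      by apply: colP0 => j; rewrite !mxE; ring.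
    by rewrite lev_online lz /kk divfK // addrC subrK.
  have := g0 i; rewrite Eg !mxE.
  have -> : (y i 0 + t * (z i 0 - y i 0)) = 0 by rewrite -wi !mxE.
  nra.
Qed.

(** A walk whose first leg is [(p, q)], whose last leg is [Z], with [j] legs after the first.
    Turning points are vertices, whereas the start and [Z.2] may be inside edges. *)
Fixpoint legs (Z : 'cV[R]_n * 'cV[R]_n) j p q : Prop :=
  edge p q /\ match j with
              | 0 => (p, q) = Z
              | j'.+1 => vert q /\ exists s, legs Z j' q s
              end.

Lemma legs_edge Z j p q : legs Z j p q -> edge p q.
Proof. by case: j => [|j] []. Qed.

(* Discrete intermediate value theorem along a walk of edges. *)
Lemma later_occurrence Z j q s h : vert q -> legs Z j q s ->
  (lev a q - h) * (lev a Z.2 - h) <= 0 ->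
  exists j' p' q' x, [/\ (j' <= j)%N, legs Z j' p' q', online p' q' x,
    svert x & lev a x = h].
Proof.
elim: j q s => [|j IH] q s vq L hh.
  have [e EZ] := L; move: hh; have -> : Z.2 = s by rewrite -EZ.
  move=> hh.
  have [eq|nq] := eqVneq (lev a q) h.
    exists 0%N, q, s, q; split=> //; [exact: online_l|exact: vert_svert].
  have [es|ns] := eqVneq (lev a q) (lev a s).
    by exfalso; move: hh; rewrite -es -expr2 leNgt lt_neqAle sqr_ge0 eq_sym expf_neq0 // subr_eq0.
  have [x ox lx] := line_point h ns.
  exists 0%N, q, s, x; split=> //.
  apply: (edge_svert e ns ox); case: (e) => [[_ q0] [_ s0] _ _].
  by apply: (between_nonneg ns (online_l q s) (online_r q s)) => //; rewrite lx; lra.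
have [e [vs [u L']]] := L.
have [eq|nq] := eqVneq (lev a q) h.
  exists j.+1, q, s, q; split=> //; [exact: online_l|exact: vert_svert].
have [le|gt] := leP ((lev a s - h) * (lev a Z.2 - h)) 0.
  have [j' [p' [q' [x [h1 h2 h3 h4 h5]]]]] := IH _ _ vs L' le.
  by exists j', p', q', x; split=> //; apply: leq_trans h1 _.
(* [h] separates [q] from the end of the walk but not [s] from it, hence it separates [q] from
   [s]. *)
have hqs : (lev a q - h) * (lev a s - h) <= 0.
  move: hh gt; set A1 := lev a q - h; set B1 := lev a s - h; set C1 := _ - h.
  move=> hh gt; rewrite leNgt; apply/negP => pos.
  have : 0 < (A1 * B1) * (B1 * C1) by apply: mulr_gt0.
  have -> : (A1 * B1) * (B1 * C1) = (A1 * C1) * B1 ^+ 2 by ring.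
  by have := sqr_ge0 B1; nra.
have ns : lev a q != lev a s.
  apply/eqP => es; move: hqs; rewrite -es -expr2 leNgt lt_neqAle sqr_ge0 eq_sym.
  by rewrite expf_neq0 // subr_eq0.
have [x ox lx] := line_point h ns.
exists j.+1, q, s, x; split=> //.
apply: (edge_svert e ns ox); case: (e) => [[_ q0] [_ s0] _ _].
by apply: (between_nonneg ns (online_l q s) (online_r q s)) => //; rewrite lx; lra.
Qed.

End Edges.

(** Only the kernel of [M] matters, so that both ways of stacking the row with the matrix are
    covered. *)
Definition slice_diam (R : realType) m n (A : 'M[R]_(m, n)) (a : 'rV[R]_n) d :=
  exists k (M : 'M[R]_(k, n)),
    (forall z : 'cV[R]_n, M *m z = 0 <-> A *m z = 0 /\ lev a z = 0) /\ mxdiam_le M d.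

(** * Vertices and steps of the 2-sum, written as pairs *)

Section Pairs.
Variables (R : realType) (m1 n1 m2 n2 : nat).
Variables (A : 'M[R]_(m1, n1)) (a : 'rV[R]_n1) (r : 'cV[R]_m1).
Variables (B : 'M[R]_(m2, n2)) (b : 'rV[R]_n2) (s : 'cV[R]_m2) (c : R).
Local Notation pair := ('cV[R]_n1 * 'cV[R]_n2)%type.

(** These are the vertices of the 2-sum by [is_vertex_twosum]; [adjpair] is the kernel criterion for
    adjacency, componentwise. *)
Definition vpair (u : pair) :=
  [/\ svert A a r u.1, svert B b s u.2, lev a u.1 + lev b u.2 = c &
      vert A r u.1 \/ vert B s u.2].

Definition adjpair (u v : pair) := [/\ vpair u, vpair v, u <> v &
  forall x y, A *m x = 0 -> B *m y = 0 -> lev a x + lev b y = 0 ->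
    ssub x (u.1 + v.1) -> ssub y (u.2 + v.2) ->
    exists k, x = k *: (v.1 - u.1) /\ y = k *: (v.2 - u.2)].

Fixpoint reach k (u v : pair) : Prop :=
  u = v \/ match k with
           | 0 => False
           | k'.+1 => exists w, adjpair u w /\ reach k' w v
           end.

Lemma reach_refl k u : reach k u u.
Proof. by case: k; left. Qed.

Lemma reach_adj u v : adjpair u v -> reach 1 u v.
Proof. by right; exists v; split=> //; left. Qed.

Lemma reach_mono j k u v : (j <= k)%N -> reach j u v -> reach k u v.
Proof.
elim: k j u => [|k IH] [|j] u //=.
- by move=> _ [->|//]; left.
- move=> jk [->|[w [uw wv]]]; first by left.
  by right; exists w; split=> //; apply: IH wv.
Qed.

Arguments reach : simpl never.

Lemma reach_trans j k u v w : reach j u v -> reach k v w -> reach (j + k) u w.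
Proof.
elim: j u => [|j IH] u; first by case=> // ->.
case=> [-> vw|[t [ut tv]] vw]; last by right; exists t; split=> //; apply: IH.
by apply: reach_mono vw; rewrite leq_addl.
Qed.

(** A direction of the joint face is a multiple of [q - p] paired with one of [q' - p']; the level
    equation fixes their ratio, so the face is one-dimensional. *)
Lemma edge_move p q p' q' x x1 y y1 :
  edge A r p q -> edge B s p' q' -> lev a p != lev a q -> lev b p' != lev b q' ->
  online p q x -> online p q x1 -> online p' q' y -> online p' q' y1 ->
  vpair (x, y) -> vpair (x1, y1) -> reach 1 (x, y) (x1, y1).
Proof.
move=> e e' nl nl' ox ox1 oy oy1 v v1.
have [[Px _] [Py _] /= l _] := v; have [[Px1 _] [Py1 _] /= l1 _] := v1.
have [ex|/eqP nx] := eqVneq x x1.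
  have <- : y = y1 by apply: (online_uniq nl' oy oy1); move: l1; rewrite -ex; lra.
  by rewrite ex; apply: reach_refl.
apply: reach_adj; split=> //; first by case.
move=> z w Az Bw lzw zs ws /=.
have [Pp Pq _ /(_ z Az)[|k Ez]] := e.
  exact: (ssub_online2 Pp Pq Px Px1 ox ox1 zs).
have [Pp' Pq' _ /(_ w Bw)[|k' Ew]] := e'.
  exact: (ssub_online2 Pp' Pq' Py Py1 oy oy1 ws).
have [t Et] := ox; have [t1 Et1] := ox1; have [u Eu] := oy; have [u1 Eu1] := oy1.
have Dx : x1 - x = (t1 - t) *: (q - p).
  by rewrite Et Et1; apply: colP0 => i; rewrite !mxE; ring.
have Dy : y1 - y = (u1 - u) *: (q' - p').
  by rewrite Eu Eu1; apply: colP0 => i; rewrite !mxE; ring.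
have dt : t1 - t != 0.
  by apply/eqP => d0; apply: nx; apply/esym/eqP; rewrite -subr_eq0 Dx d0 scale0r.
have dl' : lev b q' - lev b p' != 0 by rewrite subr_eq0 eq_sym.
have H1 : (t1 - t) * (lev a q - lev a p) + (u1 - u) * (lev b q' - lev b p') = 0.
  by rewrite -(levB a q) -(levB b q') -!levZ -Dx -Dy !levB; lra.
have H2 : k * (lev a q - lev a p) + k' * (lev b q' - lev b p') = 0.
  by rewrite -(levB a q) -(levB b q') -!levZ -Ez -Ew.
exists (k / (t1 - t)); rewrite Dx Dy !scalerA divfK //; split=> //.
rewrite Ew; congr (_ *: _); apply: (mulIf dl'); apply: (mulIf dt).
have -> : k / (t1 - t) * (u1 - u) * (lev b q' - lev b p') * (t1 - t) =
   k * ((u1 - u) * (lev b q' - lev b p')) by field.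
by move: H1 H2 => /eqP; rewrite addr_eq0 -eqr_oppLR => /eqP<- /eqP; rewrite addrC addr_eq0 => /eqP->; ring.
Qed.

(** The [x] part of a direction has level 0, hence so has its [y] part, which vanishes since [y] is
    a slice vertex. *)
Lemma flat_move p q x x1 y : edge A r p q -> lev a p = lev a q ->
  online p q x -> online p q x1 -> vpair (x, y) -> vpair (x1, y) ->
  reach 1 (x, y) (x1, y).
Proof.
move=> e fl ox ox1 v v1.
have [[Px _] [Py hy] /= l _] := v; have [[Px1 _] _ _ _] := v1.
have [->|/eqP nx] := eqVneq x x1; first exact: reach_refl.
apply: reach_adj; split=> //; first by case.
move=> z w Az Bw lzw zs ws /=.
have [Pp Pq _ /(_ z Az)[|k Ez]] := e.
  exact: (ssub_online2 Pp Pq Px Px1 ox ox1 zs).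
have [t Et] := ox; have [t1 Et1] := ox1.
have Dx : x1 - x = (t1 - t) *: (q - p).
  by rewrite Et Et1; apply: colP0 => i; rewrite !mxE; ring.
have dt : t1 - t != 0.
  by apply/eqP => d0; apply: nx; apply/esym/eqP; rewrite -subr_eq0 Dx d0 scale0r.
exists (k / (t1 - t)); rewrite Dx scalerA divfK //; split=> //.
rewrite subrr scaler0; apply: hy => //.
  by move: lzw; rewrite Ez levZ levB fl subrr mulr0 add0r.
by move=> i yi; apply: ws; rewrite mxE yi addr0.
Qed.

(** While [y] is a vertex, the [y] part of every direction is 0, so edges of the slice of [x] are
    edges of the 2-sum. *)
Lemma slice_move d x x1 y : slice_diam A a d -> svert A a r x -> svert A a r x1 ->
  lev a x = lev a x1 -> vert B s y -> lev a x + lev b y = c ->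
  reach d (x, y) (x1, y).
Proof.
move=> [k [M [hM dM]]] sx sx1 lx vy lc.
have EM z : A *m z = r -> lev a z = lev a x -> M *m z = M *m x.
  move=> Az lz; apply/eqP; rewrite -subr_eq0 -mulmxBr; apply/eqP/hM.
  by case: sx => [[Ax _] _]; rewrite mulmxBr Ax Az subrr levB lz subrr.
have V z : svert A a r z -> lev a z = lev a x -> vert M (M *m x) z.
  move=> [[Az z0] hz] lz; split; first by split=> //; apply: EM.
  by move=> w /hM[Aw lw]; apply: hz.
have V' z : vert M (M *m x) z -> svert A a r z /\ lev a z = lev a x.
  move=> [[Mz z0] hz].
  have /hM[Ad ld] : M *m (z - x) = 0 by rewrite mulmxBr Mz subrr.
  have lz : lev a z = lev a x by move: ld; rewrite levB; lra.
  split=> //; split; first split=> //.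
    by case: sx => [[<- _] _]; apply/eqP; rewrite -subr_eq0 -mulmxBr Ad.
  by move=> w Aw lw; apply: hz; apply/hM.
have W z : vert M (M *m x) z -> vpair (z, y).
  by move=> /V'[sz lz]; split; [|exact: vert_svert|rewrite /= lz|right].
have D := dM (M *m x) x x1 ((is_vertexE _ _ _).2 (V x sx erefl))
  ((is_vertexE _ _ _).2 (V x1 sx1 (esym lx))).
elim: {dM} d {2 3}x D => [|d IH] z /=; first by case=> // ->; left.
case=> [->|[w [zw wx]]]; [by left|right; exists (w, y); split; last exact: IH].
have [vz vw nzw hzw] := (adjacentE _ _ _ _).1 zw.
split; [exact: W|exact: W|by case|].
move=> u v Au Bv luv us vs; have [_ hy] := vert_svert b vy.
have v0 : v = 0.
  by case: vy => _; apply=> // i yi; apply: vs; rewrite mxE yi addr0.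
have [||k' Ek'] := hzw u => //.
  by apply/hM; split=> //; move: luv; rewrite v0 /lev mulmx0 [X in _ + X]mxE addr0.
by exists k'; rewrite /= subrr scaler0.
Qed.

End Pairs.

Arguments reach : simpl never.

(** * Exchange of the two summands *)

Section Swap.
Variables (R : realType) (m1 n1 m2 n2 : nat).
Variables (A : 'M[R]_(m1, n1)) (a : 'rV[R]_n1) (r : 'cV[R]_m1).
Variables (B : 'M[R]_(m2, n2)) (b : 'rV[R]_n2) (s : 'cV[R]_m2) (c : R).

Lemma vpair_swap x y : vpair A a r B b s c (x, y) -> vpair B b s A a r c (y, x).
Proof.
by move=> [h1 h2 /= h3 h4]; split=> //=; [rewrite addrC|case: h4; [right|left]].
Qed.

Lemma reach_swap k x y x1 y1 :
  reach A a r B b s c k (x, y) (x1, y1) -> reach B b s A a r c k (y, x) (y1, x1).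
Proof.
elim: k x y => [|k IH] x y; first by case=> // -[-> ->]; left.
case=> [[-> ->]|[[x2 y2] [[v v2 n h] /IH w]]]; first by left.
right; exists (y2, x2); split=> //; split; [exact: vpair_swap|exact: vpair_swap| |].
  by move=> -[e1 e2]; apply: n; rewrite e1 e2.
move=> y' x' By' Ax' l sy sx; have [|k' [h1 h2]] := h x' y' Ax' By' _ sx sy.
  by rewrite addrC.
by exists k'.
Qed.

End Swap.

(** * Advancing along both walks at once *)

Section Follow.
Variables (R : realType) (m1 n1 m2 n2 : nat).
Variables (A : 'M[R]_(m1, n1)) (a : 'rV[R]_n1) (r : 'cV[R]_m1).
Variables (B : 'M[R]_(m2, n2)) (b : 'rV[R]_n2) (s : 'cV[R]_m2) (c : R).
Local Notation vpair := (vpair A a r B b s c).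
Local Notation reach := (reach A a r B b s c).

Lemma edge_point_between p q x y h : edge A r p q -> lev a p != lev a q ->
  online p q x -> online p q y -> stdpoly A r x -> stdpoly A r y ->
  (h - lev a x) * (h - lev a y) <= 0 ->
  exists z, [/\ online p q z, svert A a r z & lev a z = h].
Proof.
move=> e nl ox oy [_ x0] [_ y0] hh; have [z oz lz] := line_point h nl.
exists z; split=> //; apply: (edge_svert e nl oz).
by apply: (between_nonneg nl ox oy oz) => //; rewrite lz.
Qed.

(* [x] advances to the next vertex of its walk while [y] slides along its line.
   If [y] first leaves its polyhedron, it does so at a vertex, and then [x] may
   jump inside a slice to a later leg. *)
Lemma follow da Z j p q x p' q' y : slice_diam A a da ->
  legs A r Z j.+1 p q -> online p q x ->
  edge B s p' q' -> lev b p' != lev b q' -> online p' q' y -> vpair (x, y) ->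
  (forall w, online p' q' w -> vert B s w ->
     (lev b w - lev b y) * (lev b w - (c - lev a q)) <= 0 ->
     lev b w != c - lev a q ->
     (forall g, online p' q' g -> nonneg g ->
        (lev b g - lev b w) * (c - lev a q - lev b w) <= 0) ->
     (lev a q - (c - lev b w)) * (lev a Z.2 - (c - lev b w)) <= 0) ->
  exists k i p1 q1 x1 y1,
    [/\ (i <= j)%N, (k + i * (da + 1) <= j.+1 * (da + 1))%N,
        reach k (x, y) (x1, y1) /\ vpair (x1, y1),
        legs A r Z i p1 q1 /\ online p1 q1 x1 & online p' q' y1].
Proof.
move=> dA L ox e' nl' oy v hl.
have [e [vq [t L']]] := L.
have [sx sy /= lc _] := v; have [Px _] := sx; have [Py _] := sy.
(* Either [y] can compensate the whole move of [x] to [q], in one step, or it stops at a vertex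
   [w]. *)
have [[y1 [oy1 Py1 ly1]]|[w [ow vw bt nw ext]]] := edge_exit (c - lev a q) e' nl' oy Py.
  have v1 : vpair (q, y1).
    split=> /=; [exact: vert_svert|exact: edge_svert e' nl' oy1 (proj2 Py1)| |by left].
    by rewrite ly1; ring.
  exists 1%N, j, q, t, q, y1; split=> //; [lia| |by split=> //; exact: online_l].
  split=> //; have [fl|nl] := eqVneq (lev a p) (lev a q); last first.
    by apply: (edge_move e e' nl nl' ox (online_r p q) oy oy1).
  have lx : lev a x = lev a q by rewrite (online_flat ox fl).
  have Ey : y = y1 by apply: (online_uniq nl' oy oy1); rewrite ly1 -lx -lc; ring.
  by move: v1; rewrite -Ey => v1; apply: (flat_move e fl ox (online_r p q)).
have nl : lev a p != lev a q.
  apply/eqP => fl; have lx : lev a x = lev a q by rewrite (online_flat ox fl).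
  move: bt nw; rewrite (_ : c - lev a q = lev b y); last by rewrite -lx -lc; ring.
  by rewrite -expr2 => h /eqP; apply; apply/eqP; rewrite -subr_eq0 -sqrf_eq0 eq_le h sqr_ge0.
have hq := hl w ow vw bt nw ext.
have [x' [ox' sx' lx']] : exists z,
    [/\ online p q z, svert A a r z & lev a z = c - lev b w].
  apply: (edge_point_between e nl ox (online_r p q)) => //; first by case: (vq).
  by move: bt; congr (_ <= _); rewrite -lc; ring.
(* The level [c - lev b w] recurs at or after [q]. Reaching it costs one step plus [da], paid by the
   leg that is left behind. *)
have [i [p1 [q1 [x1 [ij L1 ox1 sx1 lx1]]]]] := later_occurrence vq L' hq.
have v' : vpair (x', w).
  by split=> //=; [exact: vert_svert|rewrite lx'; ring|right].
have v1 : vpair (x1, w).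
  by split=> //=; [exact: vert_svert|rewrite lx1; ring|right].
exists (1 + da)%N, i, p1, q1, x1, w; split=> //; first by nia.
split=> //; apply: (reach_trans (v := (x', w))).
  exact: (edge_move e e' nl nl' ox ox' oy ow).
apply: slice_move => //; first by rewrite lx1.
by rewrite lx'; ring.
Qed.

End Follow.

(** Each leg after the current one costs [da + 1] or [db + 1], and one step finishes. The spare [f]
    is for two level last legs, which may need a step each. All data are quantified so that the
    induction hypothesis also serves after a swap. *)
Definition climbs_in (R : realType) N := forall m1 n1 m2 n2
  (A : 'M[R]_(m1, n1)) (a : 'rV[R]_n1) (r : 'cV[R]_m1)
  (B : 'M[R]_(m2, n2)) (b : 'rV[R]_n2) (s : 'cV[R]_m2) (c : R)
  da db Z W f i j p q x p' q' y, (i + j < N)%N ->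
  slice_diam A a da -> slice_diam B b db ->
  legs A r Z i p q -> online p q x -> legs B s W j p' q' -> online p' q' y ->
  vpair A a r B b s c (x, y) -> vpair A a r B b s c (Z.2, W.2) ->
  [|| lev a Z.1 != lev a Z.2, lev b W.1 != lev b W.2 | 0 < f]%N ->
  reach A a r B b s c (i * (da + 1) + j * (db + 1) + 1 + f)%N (x, y) (Z.2, W.2).

Section Climb.
Variables (R : realType) (m1 n1 m2 n2 : nat).
Variables (A : 'M[R]_(m1, n1)) (a : 'rV[R]_n1) (r : 'cV[R]_m1).
Variables (B : 'M[R]_(m2, n2)) (b : 'rV[R]_n2) (s : 'cV[R]_m2) (c : R).
Local Notation vpair := (vpair A a r B b s c).
Local Notation reach := (reach A a r B b s c).
Variables (da db : nat).
Hypothesis dA : slice_diam A a da.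
Hypothesis dB : slice_diam B b db.

(** Since its last leg is level, [y] can go to the vertex [q'] at once; then [x] finishes by a slice
    walk paid by a remaining leg, by a level step, or is already at its end. *)
Lemma climb_last_flat Z W f i p q x p' q' y :
  legs A r Z i p q -> online p q x -> legs B s W 0 p' q' -> online p' q' y ->
  vpair (x, y) -> vpair (Z.2, W.2) -> lev b p' = lev b q' ->
  [|| lev a Z.1 != lev a Z.2, lev b W.1 != lev b W.2 | 0 < f]%N ->
  reach (i * (da + 1) + 1 + f)%N (x, y) (Z.2, W.2).
Proof.
move=> L ox [e' EW] oy v vZ fl' hf.
have EW2 : W.2 = q' by rewrite -EW.
rewrite EW2 in vZ *.
have vq' : vert B s q' by apply: (flat_vert e' fl' (online_r _ _)); case: vZ.
have [sx sy /= lc _] := v; have [sz _ /= lcz _] := vZ.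
have ly : lev b y = lev b q' by rewrite (online_flat oy fl').
have v1 : vpair (x, q') by split=> //=; [exact: vert_svert|rewrite -ly|right].
have M : reach 1 (x, y) (x, q').
  apply: reach_swap; apply: (flat_move e' fl' oy (online_r _ _)); exact: vpair_swap.
case: i L => [|i] L; last first.
  apply: (reach_mono (j := (1 + da)%N)); first by nia.
  apply: (reach_trans M); apply: slice_move => //; last by rewrite -ly.
  by move: lc lcz; rewrite ly; lra.
have [e EZ] := L; have EZ2 : Z.2 = q by rewrite -EZ.
have EZ1 : Z.1 = p by rewrite -EZ.
rewrite EZ2 in vZ lcz *.
have [fl|nl] := eqVneq (lev a p) (lev a q).
  have f0 : (0 < f)%N.
    by move: hf; rewrite EZ1 EZ2 -EW /= fl fl' !eqxx.
  apply: (reach_mono (j := (1 + 1)%N)); first by lia.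
  by apply: (reach_trans M); apply: (flat_move e fl ox (online_r _ _)).
have -> : q = x.
  by apply: (online_uniq nl (online_r _ _) ox); move: lc lcz; rewrite ly; lra.
by apply: reach_mono M; lia.
Qed.

Variable N : nat.
Hypothesis IH : climbs_in R N.

Lemma climb_last Z W f i p q x p' q' y : (i < N.+1)%N ->
  legs A r Z i p q -> online p q x -> legs B s W 0 p' q' -> online p' q' y ->
  vpair (x, y) -> vpair (Z.2, W.2) ->
  [|| lev a Z.1 != lev a Z.2, lev b W.1 != lev b W.2 | 0 < f]%N ->
  reach (i * (da + 1) + 1 + f)%N (x, y) (Z.2, W.2).
Proof.
move=> iN L ox L' oy v vZ hf.
have [fl'|nl'] := eqVneq (lev b p') (lev b q').
  exact: (climb_last_flat L ox L' oy).
have [e' EW] := L'; have EW2 : W.2 = q' by rewrite -EW.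
have [sx sy /= lc _] := v; have [sz sw /= lcz _] := vZ.
rewrite EW2 in lcz sw.
case: i iN L => [|i] iN L.
  have [e EZ] := L; have EZ2 : Z.2 = q by rewrite -EZ.
  rewrite EW2 EZ2 in vZ sz lcz *.
  apply: (reach_mono (j := 1%N)); first by lia.
  have [fl|nl] := eqVneq (lev a p) (lev a q); last first.
    exact: (edge_move e e' nl nl' ox (online_r _ _) oy (online_r _ _)).
  have E : q' = y.
    apply: (online_uniq nl' (online_r _ _) oy); have := online_flat ox fl.
    by move: lc lcz; rewrite fl; lra.
  by move: vZ; rewrite E => vZ; apply: (flat_move e fl ox (online_r _ _)).
have [|k [i' [p1 [q1 [x1 [y1 [ij kk [rch v1] [L1 ox1] oy1]]]]]]] :=
    follow dA L ox e' nl' oy v.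
  (* [q'] is a point of the edge that ends at [w], so its level is on the far side of [w]; in terms
     of [x] this is the required separation. *)
  move=> w ow vw _ _ /(_ q' (online_r _ _)); case: sw => [[_ q0] _] /(_ q0).
  have -> : lev a Z.2 = c - lev b q' by rewrite -lcz; ring.
  by congr (_ <= _); ring.
apply: (reach_mono (j := (k + (i' * (da + 1) + 0 * (db + 1) + 1 + f))%N)); first by lia.
by apply: (reach_trans rch); apply: (IH _ dA dB L1 ox1 L' oy1) => //; lia.
Qed.

Lemma climb_step Z W f i j p q x p' q' y : (i.+1 + j.+1 < N.+1)%N -> vert A r x ->
  legs A r Z i.+1 p q -> online p q x -> legs B s W j.+1 p' q' -> online p' q' y ->
  vpair (x, y) -> vpair (Z.2, W.2) ->
  [|| lev a Z.1 != lev a Z.2, lev b W.1 != lev b W.2 | 0 < f]%N ->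
  reach (i.+1 * (da + 1) + j.+1 * (db + 1) + 1 + f)%N (x, y) (Z.2, W.2).
Proof.
move=> ijN vx L ox L' oy v vZ hf.
have [e [vq [t Lq]]] := L; have [e' [vq' [t' Lq']]] := L'.
have [sx sy /= lc _] := v; have [sz sw /= lcz _] := vZ.
have [Px _] := sx; have [Py _] := sy.
(* The walk of [y] returns to its present level: as [x] is a vertex, [y] jumps there for [db] steps
   and leaves a leg behind. *)
have [le|gt] := leP ((lev b q' - lev b y) * (lev b W.2 - lev b y)) 0.
  have [j' [p1 [q1 [y1 [jj L1 oy1 sy1 ly1]]]]] := later_occurrence vq' Lq' le.
  have v1 : vpair (x, y1) by split=> //=; [rewrite ly1|left].
  apply: (reach_mono (j := (db + (i.+1 * (da + 1) + j' * (db + 1) + 1 + f))%N)); first by nia.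
  apply: (reach_trans (v := (x, y1))); last first.
    by apply: (IH _ dA dB L ox L1 oy1) => //; lia.
  by apply: reach_swap; apply: slice_move => //; rewrite 1?addrC.
have nl' : lev b p' != lev b q'.
  apply/eqP => fl; have := online_flat oy fl; rewrite fl => ly.
  by move: gt; rewrite ly subrr mul0r ltxx.
(* Moving [x] to [q] would not bring [y] towards [q']: [follow] applies, the end of the walk of [y]
   being on the other side. *)
have [op|sm] := leP ((c - lev a q - lev b y) * (lev b q' - lev b y)) 0.
  have [|k [i' [p1 [q1 [x1 [y1 [ij kk [rch v1] [L1 ox1] oy1]]]]]]] :=
      follow dA L ox e' nl' oy v.
    move=> w ow vw; rewrite (_ : lev a Z.2 = c - lev b W.2); last by rewrite -lcz; ring.
    rewrite (_ : (lev a q - (c - lev b w)) * (c - lev b W.2 - (c - lev b w))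
      = (c - lev a q - lev b w) * (lev b W.2 - lev b w)); last by ring.
    move: gt op; set u := c - lev a q; set W2 := lev b W.2.
    set Y := lev b y; set Q := lev b q'; set w' := lev b w.
    move=> gt op bt nw _.
    have [QY|QY] := leP Q Y.
      have WY : W2 < Y by nra.
      have : Y <= u by nra.
      nra.
    have WY : Y < W2 by nra.
    have : u <= Y by nra.
    nra.
  apply: (reach_mono (j := (k + (i' * (da + 1) + j.+1 * (db + 1) + 1 + f))%N)); first by lia.
  by apply: (reach_trans rch); apply: (IH _ dA dB L1 ox1 L' oy1) => //; lia.
have nl : lev a p != lev a q.
  apply/eqP => fl; have := online_flat ox fl; rewrite fl => lx.
  move: sm; rewrite (_ : c - lev a q - lev b y = 0) ?mul0r ?ltxx //.
  by rewrite -lx -lc; ring.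
(* Both now move towards the ends of their legs, and here [x] reaches [q] no later than [y] reaches
   [q']. *)
have [le|gt2] := leP ((c - lev a q - lev b y) * (c - lev a q - lev b q')) 0.
  have [y1 [oy1 sy1 ly1]] : exists z,
      [/\ online p' q' z, svert B b s z & lev b z = c - lev a q].
    by apply: (edge_point_between e' nl' oy (online_r _ _)) => //; case: vq'.
  have v1 : vpair (q, y1).
    by split=> //=; [exact: vert_svert|rewrite ly1; ring|left].
  apply: (reach_mono (j := (1 + (i * (da + 1) + j.+1 * (db + 1) + 1 + f))%N)); first by nia.
  apply: (reach_trans (edge_move e e' nl nl' ox (online_r _ _) oy oy1 v v1)).
  by apply: (IH _ dA dB Lq (online_l _ _) L' oy1) => //; lia.
(* In the remaining case [y] reaches [q'] first. *)
have [x1 [ox1 sx1 lx1]] : exists z,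
    [/\ online p q z, svert A a r z & lev a z = c - lev b q'].
  apply: (edge_point_between e nl ox (online_r _ _)) => //; first by case: vq.
  rewrite (_ : lev a x = c - lev b y); last by rewrite -lc; ring.
  move: sm gt2; set u := lev a q; set Y := lev b y; set Q := lev b q' => sm gt2.
  have [QY|QY] := leP Q Y; nra.
have v1 : vpair (x1, q').
  by split=> //=; [exact: vert_svert|rewrite lx1; ring|right].
apply: (reach_mono (j := (1 + (i.+1 * (da + 1) + j * (db + 1) + 1 + f))%N)); first by nia.
apply: (reach_trans (edge_move e e' nl nl' ox ox1 oy (online_r _ _) v v1)).
by apply: (IH _ dA dB L ox1 Lq' (online_l _ _)) => //; lia.
Qed.

End Climb.

Lemma climb (R : realType) N : climbs_in R N.
Proof.
elim: N => [|N IH] // m1 n1 m2 n2 A a r B b s c da db Z W f i j p q x p' q' y.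
move=> ijN dA dB L ox L' oy v vZ hf.
have hf' : [|| lev b W.1 != lev b W.2, lev a Z.1 != lev a Z.2 | 0 < f]%N.
  by move: hf; rewrite orbCA.
case: j ijN L' => [|j] ijN L'.
  rewrite mul0n addn0; apply: (climb_last dA dB IH _ L ox L' oy) => //; lia.
case: i ijN L => [|i] ijN L.
  rewrite mul0n add0n; apply: reach_swap.
  by apply: (climb_last dB dA IH _ L' oy L ox) => //; first [exact: vpair_swap|lia].
have [_ _ _ /= [vx|vy]] := v.
  by apply: (climb_step dA dB IH _ vx L ox L' oy).
rewrite [(i.+1 * _ + _)%N]addnC; apply: reach_swap.
by apply: (climb_step dB dA IH _ vy L' oy L ox) => //; first [exact: vpair_swap|lia].
Qed.

(** * Existence of walks between slice vertices *)

Section Walks.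
Variables (R : realType) (m n : nat) (A : 'M[R]_(m, n)) (a : 'rV[R]_n).
Variable r : 'cV[R]_m.
Implicit Types (p q x y z u v w : 'cV[R]_n).

Lemma not_vert x : stdpoly A r x -> ~ vert A r x ->
  exists d, [/\ d <> 0, A *m d = 0 & ssub d x].
Proof.
move=> Px nv; apply: contrapT => h; apply: nv; split=> // z Az zx.
by apply: contrapT => nz; apply: h; exists z.
Qed.

Lemma stdpoly_move x d k : stdpoly A r x -> A *m d = 0 -> nonneg (x + k *: d) ->
  stdpoly A r (x + k *: d).
Proof. by move=> [Ax _] Ad h; split=> //; rewrite mulmxDr (ker_scale k Ad) addr0. Qed.

(** Following a direction inside the support until a coordinate vanishes shrinks the support; the
    induction is on its size. *)
Lemma vertex_below x : stdpoly A r x -> exists2 p, vert A r p & ssub p x.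
Proof.
have [k] := ubnP #|[set i | x i 0 != 0]|; elim: k x => // k IH x xk Px.
have [vx|/(not_vert Px)[d [dnz Ad dx]]] := EM (vert A r x).
  by exists x.
have [t [j [h xj dj ej]]] := boundary_step Px.2 dnz dx.
have sx : ssub (x + t *: d) x by move=> i xi; rewrite !mxE xi dx // mulr0 addr0.
have [||p vp hp] := IH (x + t *: d); [|exact: stdpoly_move|].
  rewrite ltnS in xk; apply: leq_trans xk; apply: proper_card; apply/properP; split.
    apply/subsetP => i; rewrite !inE; apply: contraNneq => xi.
    by rewrite sx.
  by exists j; rewrite !inE ?ej ?eqxx //; apply/eqP.
by exists p => // i xi; apply: hp; apply: sx.
Qed.

(** At a slice vertex the level is injective on the directions inside the support, so these form at
    most a line. *)
Lemma svert_ker_line v x y : svert A a r v -> A *m x = 0 -> A *m y = 0 ->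
  ssub x v -> ssub y v -> x <> 0 -> lev a x != 0 /\ y = (lev a y / lev a x) *: x.
Proof.
move=> [Pv hv] Ax Ay xv yv xnz.
have lx : lev a x != 0 by apply/eqP => lx; apply: xnz; apply: hv.
split=> //; apply/eqP; rewrite -subr_eq0; apply/eqP; apply: hv.
- by rewrite mulmxBr (ker_scale _ Ax) Ay subrr.
- by rewrite levB levZ divfK // subrr.
- by move=> i vi; rewrite !mxE xv // yv // mulr0 subrr.
Qed.

(** The line of directions at [x] spans an edge; [boundary_step] follows it to an end [u]. *)
Lemma svert_edge x : svert A a r x -> ~ vert A r x ->
  exists u, [/\ vert A r u, edge A r x u & lev a x != lev a u].
Proof.
move=> sx nv; have [Px hx] := sx; have [d [dnz Ad dx]] := not_vert Px nv.
have [t [j [h xj dj ej]]] := boundary_step Px.2 dnz dx.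
have Pu := stdpoly_move Px Ad h.
have t0 : t != 0 by apply/eqP => t0; move: ej; rewrite t0 scale0r addr0.
have [ld _] := svert_ker_line sx Ad Ad dx dx dnz.
have sux z : ssub z (x + t *: d) -> ssub z x.
  by move=> h' i xi; apply: h'; rewrite !mxE xi dx // mulr0 addr0.
exists (x + t *: d); split.
- split=> // z Az zu; have [_ Ez] := svert_ker_line sx Ad Az dx (sux z zu) dnz.
  have : (lev a z / lev a d) * d j 0 = 0 by rewrite -(zu j ej) {2}Ez mxE.
  by move=> /eqP; rewrite mulf_eq0 => /orP[/eqP e|/eqP //]; rewrite Ez e scale0r.
- split=> // [e|z Az zs].
    by move: ej; rewrite -e.
  have zx : ssub z x.
    move=> i xi; apply: zs; rewrite mxE xi add0r.
    by rewrite !mxE xi dx // mulr0 addr0.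
  have [_ ->] := svert_ker_line sx Ad Az dx zx dnz.
  exists (lev a z / lev a d / t).
  by rewrite [x + _]addrC addrK scalerA divfK.
- by rewrite levD levZ -subr_eq0 opprD addNKr oppr_eq0 mulf_neq0.
Qed.

Lemma path_legs k u w : dist_le (stdpoly A r) k u w -> u = w \/
  exists j Z q, [/\ (j < k)%N, legs A r Z j u q & Z.2 = w].
Proof.
elim: k u => [|k IH] u /=; first by case=> //; left.
case=> [->|[t [ut /IH h]]]; [by left|right].
have e := adjacent_edge ut; have [_ vt _ _] := (adjacentE _ _ _ _).1 ut.
case: h => [<-|[j [Z [q [jk L E]]]]]; first by exists 0%N, (u, t), t.
by exists j.+1, Z, t; split=> //; split=> //; split=> //; exists q.
Qed.

Lemma legs_extend Z j p q x : legs A r Z j p q -> vert A r Z.2 -> edge A r Z.2 x ->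
  legs A r (Z.2, x) j.+1 p q.
Proof.
elim: j p q => [|j IH] p q /=.
  by move=> [e EZ] v ex; rewrite -EZ /= in v ex *; split=> //; split=> //; exists x.
by move=> [e [vq [s L]]] v ex; split=> //; split=> //; exists s; apply: IH.
Qed.

(** A path between vertices is prolonged by one edge when an end is not a vertex. That edge is not
    level, which supplies the side condition of [climbs_in]; two vertex ends save a leg. *)
Lemma walk_exists d x1 x2 : mxdiam_le A d -> svert A a r x1 -> svert A a r x2 ->
  vert A r x1 \/ vert A r x2 ->
  (x1 = x2 /\ vert A r x1) \/
  exists j Z q, [/\ legs A r Z j x1 q, Z.2 = x2, (j <= d)%N,
    vert A r x1 -> vert A r x2 -> (j < d)%N &
    ~ vert A r x2 -> lev a Z.1 != lev a Z.2].
Proof.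
move=> dA s1 s2 v12.
have path u w : vert A r u -> vert A r w -> dist_le (stdpoly A r) d u w.
  by move=> vu vw; apply: dA; apply/is_vertexE.
have [v1|n1] := EM (vert A r x1); have [v2|n2] := EM (vert A r x2).
- have [->|[j [Z [q [jd L E]]]]] := path_legs (path _ _ v1 v2); first by left.
  by right; exists j, Z, q; split=> //; exact: ltnW.
- have [u [vu /edge_sym e nl]] := svert_edge s2 n2; right.
  have [E|[j [Z [q [jd L E]]]]] := path_legs (path _ _ v1 vu).
    by exists 0%N, (u, x2), x2; rewrite E; split=> //= _; rewrite eq_sym.
  exists j.+1, (u, x2), q; split=> //=; last by rewrite eq_sym.
  by rewrite -E; apply: legs_extend => //; rewrite E.
- have [u [vu e nl]] := svert_edge s1 n1; right.
  have [E|[j [Z [q [jd L E]]]]] := path_legs (path _ _ vu v2).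
    by exists 0%N, (x1, u), u; rewrite E in e *; split.
  by exists j.+1, Z, u; split=> //; split=> //; split=> //; exists q.
- by case: v12.
Qed.

End Walks.

(** * Two ends inside edges, and the bound for pairs *)

Section Prelude.
Variables (R : realType) (m1 n1 m2 n2 : nat).
Variables (A : 'M[R]_(m1, n1)) (a : 'rV[R]_n1) (r : 'cV[R]_m1).
Variables (B : 'M[R]_(m2, n2)) (b : 'rV[R]_n2) (s : 'cV[R]_m2) (c : R).
Local Notation vpair := (vpair A a r B b s c).
Local Notation reach := (reach A a r B b s c).

(** [edge_exit] on the line of [x] decides which comes first: [y] at [q'], or [x] at an end [w] of
    its edge. *)
Lemma slide_leg p q x p' q' : edge A r p q -> lev a p != lev a q ->
  online p q x -> edge B s p' q' -> vert B s p' -> vert B s q' -> vpair (x, p') ->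
  (exists x1, [/\ online p q x1, vpair (x1, q') & reach 1 (x, p') (x1, q')]) \/
  exists w y1, [/\ vert A r w, online p' q' y1, vpair (w, y1) &
                   reach 1 (x, p') (w, y1)].
Proof.
move=> e nl ox e' vp vq v; have [[Px _] _ /= lc _] := v.
have [[x1 [ox1 Px1 lx1]]|[w [ow vw bt nw _]]] := edge_exit (c - lev b q') e nl ox Px.
  left; exists x1; have v1 : vpair (x1, q').
    split=> /=; [exact: edge_svert e nl ox1 Px1.2|exact: vert_svert| |by right].
    by rewrite lx1; ring.
  split=> //; have [fl|nl'] := eqVneq (lev b p') (lev b q'); last first.
    exact: (edge_move e e' nl nl' ox ox1 (online_l _ _) (online_r _ _)).
  have Ex : x1 = x by apply: (online_uniq nl ox1 ox); rewrite lx1 -fl -lc; ring.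
  rewrite Ex in v1 *; apply: reach_swap.
  by apply: (flat_move e' fl (online_l _ _) (online_r _ _)); exact: vpair_swap.
right; have nl' : lev b p' != lev b q'.
  apply/eqP => fl; move: bt nw.
  rewrite (_ : c - lev b q' = lev a x); last by rewrite -fl -lc; ring.
  by rewrite -expr2 => h /eqP; apply; apply/eqP; rewrite -subr_eq0 -sqrf_eq0 eq_le h sqr_ge0.
have [y1 [oy1 sy1 ly1]] : exists z,
    [/\ online p' q' z, svert B b s z & lev b z = c - lev a w].
  apply: (edge_point_between e' nl' (online_l _ _) (online_r _ _)); [by case: vp|by case: vq|].
  by move: bt; congr (_ <= _); rewrite -lc; ring.
have v1 : vpair (w, y1).
  by split=> //=; [exact: vert_svert|rewrite ly1; ring|left].
exists w, y1; split=> //.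
exact: (edge_move e e' nl nl' ox ow (online_l _ _) oy1).
Qed.

(* [x] stays on the line of [p] and [q] while [y] follows its walk: either [y]
   completes it, or [x] reaches a vertex. *)
Lemma slide p q x W j p' q' : edge A r p q -> lev a p != lev a q -> online p q x ->
  legs B s W j p' q' -> vert B s W.2 -> vert B s p' -> vpair (x, p') ->
  (exists2 x1, vpair (x1, W.2) & reach j.+1 (x, p') (x1, W.2)) \/
  exists k i w p1 q1 y1, [/\ vert A r w, legs B s W i p1 q1 /\ online p1 q1 y1,
    vpair (w, y1), reach k (x, p') (w, y1) & (k + i <= j.+1)%N].
Proof.
move=> e nl; elim: j x p' q' => [|j IH] x p' q' ox L vW vp v; have e' := legs_edge L.
  have vq : vert B s q' by case: L vW => _ <-.
  have [[x1 [ox1 v1 M]]|[w [y1 [vw oy1 v1 M]]]] := slide_leg e nl ox e' vp vq v.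
    by left; exists x1; case: L => [_ <-].
  by right; exists 1%N, 0%N, w, p', q', y1.
have [_ [vq [t L']]] := L.
have [[x1 [ox1 v1 M]]|[w [y1 [vw oy1 v1 M]]]] := slide_leg e nl ox e' vp vq v.
  case: (IH x1 q' t ox1 L' vW vq v1) => [[x2 v2 h]|[k [i [w [p1 [q1 [y1 [h1 h2 h3 h4 h5]]]]]]]].
    by left; exists x2 => //; apply: (reach_trans M h).
  by right; exists (1 + k)%N, i, w, p1, q1, y1; split=> //; exact: (reach_trans M h4).
by right; exists 1%N, j.+1, w, p', q', y1.
Qed.

Variables (dA dB da db : nat).
Hypotheses (dA_A : mxdiam_le A dA) (dB_B : mxdiam_le B dB).
Hypotheses (da_A : slice_diam A a da) (db_B : slice_diam B b db).
Hypotheses (da1 : dA = 0%N -> (da <= 1)%N) (db1 : dB = 0%N -> (db <= 1)%N).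
Let D := (dA * (da + 1) + dB * (db + 1))%N.

Lemma pair_diam_slide x1 y1 x2 y2 : vpair (x1, y1) -> vpair (x2, y2) ->
  ~ vert A r x1 -> ~ vert A r x2 -> reach (D + 1) (x1, y1) (x2, y2).
Proof.
move=> v1 v2 nv1 nv2.
have [/= s1 _ l1 [//|vy1]] := v1; have [/= s2 _ l2 [//|vy2]] := v2.
(* This pays for sliding along the whole walk of [y] and then correcting [x] in its slice; for
   [dA = 0] it rests on [da <= 1]. *)
have daD : (da + dB <= D + 1)%N.
  rewrite /D; case: (dA) da1 => [|k] h; last by nia.
  by have := h erefl; nia.
have [u [vu e nl]] := svert_edge s1 nv1.
have : dist_le (stdpoly B s) dB y1 y2 by apply: dB_B; apply/is_vertexE.
move=> /path_legs[E|[j [W [q' [jd L E]]]]].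
  rewrite E in v1 l1 *; apply: (reach_mono (j := da)); first by lia.
  by apply: slice_move => //; lra.
have vW : vert B s W.2 by rewrite E.
case: (slide e nl (online_l _ _) L vW vy1 v1).
  rewrite E => -[x' v' h].
  apply: (reach_mono (j := (j.+1 + da)%N)); first by lia.
  apply: (reach_trans h); have [s' _ /= l' _] := v'.
  by apply: slice_move => //; lra.
move=> [k [i [w [p1 [q1 [y [vw [L1 oy] vwy h ki]]]]]]].
have [[E' _] | [j' [Z [q [Lx EZ jd' _ nf]]]]] :=
    walk_exists dA_A (vert_svert a vw) s2 (or_introl vw).
  by case: nv2; rewrite -E'.
(* The spare is 0 because the last leg towards [x2], not a vertex, is not level. *)
apply: (reach_mono (j := (k + (j' * (da + 1) + i * (db + 1) + 1 + 0))%N)); first by rewrite /D; nia.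
apply: (reach_trans h); rewrite -{1}EZ -{1}E.
apply: (climb (N := (j' + i).+1) _ da_A db_B Lx (online_l _ _) L1 oy) => //.
  by rewrite EZ E.
by rewrite nf.
Qed.

End Prelude.

Lemma pair_diam (R : realType) m1 n1 m2 n2
  (A : 'M[R]_(m1, n1)) (a : 'rV[R]_n1) (r : 'cV[R]_m1)
  (B : 'M[R]_(m2, n2)) (b : 'rV[R]_n2) (s : 'cV[R]_m2) (c : R) dA dB da db :
  mxdiam_le A dA -> mxdiam_le B dB -> slice_diam A a da -> slice_diam B b db ->
  (dA = 0%N -> (da <= 1)%N) -> (dB = 0%N -> (db <= 1)%N) ->
  forall x1 y1 x2 y2,
  vpair A a r B b s c (x1, y1) -> vpair A a r B b s c (x2, y2) ->
  reach A a r B b s c (dA * (da + 1) + dB * (db + 1) + 1) (x1, y1) (x2, y2).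
Proof.
move=> hA hB ha hb a1 b1 x1 y1 x2 y2 v1 v2.
have [nx|/not_andP hx] := EM (~ vert A r x1 /\ ~ vert A r x2).
  by apply: pair_diam_slide => //; case: nx.
have [ny|/not_andP hy] := EM (~ vert B s y1 /\ ~ vert B s y2).
  rewrite [(dA * _ + _)%N]addnC; apply: reach_swap.
  by apply: pair_diam_slide => //; try exact: vpair_swap; case: ny.
have {}hx : vert A r x1 \/ vert A r x2 by case: hx => /contrapT; [left|right].
have {}hy : vert B s y1 \/ vert B s y2 by case: hy => /contrapT; [left|right].
have [/= sx1 sy1 l1 o1] := v1; have [/= sx2 sy2 l2 o2] := v2.
have [[Ex vx]|[i [Z [q [LX EZ ia ia' nfX]]]]] := walk_exists hA sx1 sx2 hx.
  rewrite -Ex in l2 *.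
  apply: (reach_mono (j := db)).
    (* Only [y] moves, for [db] steps; if [dB = 0] the bound leaves one step, hence [db <= 1]. *)
    by case: (dB) b1 => [|k] h; [have := h erefl; lia|nia].
  by apply: reach_swap; apply: slice_move => //; lra.
have [[Ey vy]|[j [W [q' [LY EW jb jb' nfY]]]]] := walk_exists hB sy1 sy2 hy.
  rewrite -Ey in l2 *.
  apply: (reach_mono (j := da)).
    by case: (dA) a1 => [|k] h; [have := h erefl; lia|nia].
  by apply: slice_move => //; lra.
have C f : [|| lev a Z.1 != lev a Z.2, lev b W.1 != lev b W.2 | 0 < f]%N ->
    reach A a r B b s c (i * (da + 1) + j * (db + 1) + 1 + f) (x1, y1) (x2, y2).
  move=> hf; rewrite -{1}EZ -{1}EW.
  apply: (climb (N := (i + j).+1) _ ha hb LX (online_l _ _) LY (online_l _ _)) => //.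
  by rewrite EZ EW.
(* With two vertex ends the walk has a leg fewer than allowed, which pays for the spare step. *)
have [[vx1 vx2]|/not_andP nX] := EM (vert A r x1 /\ vert A r x2).
  have := ia' vx1 vx2 => id.
  by apply: reach_mono (C 1%N _); [nia|rewrite !orbT].
have [[vy1 vy2]|/not_andP nY] := EM (vert B s y1 /\ vert B s y2).
  have := jb' vy1 vy2 => jd.
  by apply: reach_mono (C 1%N _); [nia|rewrite !orbT].
apply: reach_mono (C 0%N _); first by nia.
(* If [x2] is a vertex, then [x1] is not, so [y1] is a vertex and [y2] is not: one last leg is never
   level. *)
have [vx2|/nfX->//] := EM (vert A r x2).
by rewrite nfY ?orbT //; tauto.
Qed.

(** * Slices when the matrix has diameter 0 *)

Section ZeroDiameter.
Variables (R : realType) (m n : nat) (A : 'M[R]_(m, n)) (a : 'rV[R]_n).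
Hypothesis A0 : mxdiam_le A 0.
Implicit Types (x y z v w g h : 'cV[R]_n).

Definition pos z : 'cV[R]_n := \col_i Num.max (z i 0) 0.
Definition off h g : 'cV[R]_n := \col_i (if g i 0 == 0 then h i 0 else 0).

Lemma pos_nonneg z : nonneg (pos z).
Proof. by move=> i; rewrite mxE le_max lexx orbT. Qed.

Lemma posB z : z = pos z - pos (- z).
Proof.
apply: colP0 => i; rewrite !mxE.
by have [h|h] := leP (z i 0) 0; have [h'|h'] := leP (- z i 0) 0; lra.
Qed.

Lemma pos_disjoint z i : pos z i 0 = 0 \/ pos (- z) i 0 = 0.
Proof.
rewrite !mxE; have [h|h] := leP (z i 0) 0; [by left|right].
by apply: max_r; lra.
Qed.

(* The polyhedron of [A *m pos z] contains [pos z] and [pos (- z)], whose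
   supports are disjoint, so its only vertex is [0]. *)
Lemma ker_pos z : A *m z = 0 -> A *m pos z = 0.
Proof.
move=> Az; have E : A *m pos (- z) = A *m pos z.
  by apply/esym/eqP; rewrite -subr_eq0 -mulmxBr -posB Az.
have P1 : stdpoly A (A *m pos z) (pos z) by split=> //; exact: pos_nonneg.
have P2 : stdpoly A (A *m pos z) (pos (- z)) by split=> //; exact: pos_nonneg.
have [p vp hp] := vertex_below P1; have [q vq hq] := vertex_below P2.
have [pq|//] : dist_le (stdpoly A (A *m pos z)) 0 p q by apply: A0; apply/is_vertexE.
have p0 : p = 0.
  apply: colP0 => i; rewrite [RHS]mxE.
  by have [/hp//|/hq] := pos_disjoint z i; rewrite -pq.
by case: vp => [[<- _] _]; rewrite p0 mulmx0.
Qed.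

(** For large [N] it is the positive part of [h - N *: g]. *)
Lemma ker_off h g : nonneg h -> nonneg g -> A *m h = 0 -> A *m g = 0 ->
  A *m off h g = 0.
Proof.
move=> h0 g0 Ah Ag; pose N := \sum_i h i 0 / g i 0.
have -> : off h g = pos (h - N *: g).
  apply: colP0 => i; rewrite !mxE; have [gi|gi] := eqVneq (g i 0) 0.
    by rewrite gi mulr0 subr0 max_l.
  have gi0 : 0 < g i 0 by rewrite lt_neqAle eq_sym gi /=.
  have : h i 0 / g i 0 <= N.
    rewrite /N (bigD1 i) //= lerDl; apply: sumr_ge0 => j _; exact: divr_ge0.
  by rewrite ler_pdivrMr // => hN; rewrite max_r // subr_le0.
by apply: ker_pos; rewrite mulmxBr Ah (ker_scale _ Ag) subrr.
Qed.

(** Otherwise [v] is at most [w] entrywise, and [w - v] is a level direction supported in the slice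
    vertex [w]. *)
Lemma svert_diff_pos r v w : svert A a r v -> svert A a r w -> lev a v = lev a w ->
  v <> w -> pos (v - w) <> 0.
Proof.
move=> [Pv hv] [Pw hw] lvw nvw p0; apply: nvw.
have E : v - w = - pos (w - v) by rewrite {1}(posB (v - w)) p0 sub0r opprB.
have : w - v = 0; last by move=> /eqP; rewrite subr_eq0 => /eqP.
apply: hw; [exact: stdpoly_ker Pv Pw|by rewrite levB lvw subrr|].
move=> i wi; have := pos_nonneg (w - v) i; have := Pv.2 i.
by have := congr1 (fun f : 'cV_n => f i 0) E; rewrite !mxE wi; lra.
Qed.

(** [ker_off] strips from [h] its parts on the supports of the two generators. These parts lie in
    the supports of [v] and [w], where [svert_ker_line] makes them multiples of the generators; the
    remainder vanishes. *)
Lemma ker_pos_span r v w h : svert A a r v -> svert A a r w -> lev a v = lev a w ->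
  v <> w -> nonneg h -> A *m h = 0 -> ssub h (v + w) ->
  exists k l, h = k *: pos (v - w) + l *: pos (w - v).
Proof.
move=> sv sw lvw nvw h0 Ah hs; have [Pv _] := sv; have [Pw _] := sw.
pose g := pos (v - w); pose f := pos (w - v).
have gnz : g <> 0 by exact: svert_diff_pos sv sw lvw nvw.
have fnz : f <> 0 by apply: (svert_diff_pos sw sv) => // e; apply: nvw.
have Ag : A *m g = 0 by apply: ker_pos; exact: stdpoly_ker Pw Pv.
have Af : A *m f = 0 by apply: ker_pos; exact: stdpoly_ker Pv Pw.
have gE i : g i 0 = Num.max (v i 0 - w i 0) 0 by rewrite !mxE.
have fE i : f i 0 = Num.max (w i 0 - v i 0) 0 by rewrite !mxE.
have v0 i : 0 <= v i 0 by case: Pv.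
have w0 i : 0 <= w i 0 by case: Pw.
have gv : ssub g v by move=> i vi; rewrite gE max_r // vi sub0r oppr_le0.
have fw : ssub f w by move=> i wi; rewrite fE max_r // wi sub0r oppr_le0.
have offE h' g' i : off h' g' i 0 = if g' i 0 == 0 then h' i 0 else 0 by rewrite mxE.
have subE x y i : (x - y) i 0 = x i 0 - y i 0 by rewrite !mxE.
have off0 h' g' : nonneg h' -> nonneg (off h' g') by move=> h0' i; rewrite mxE; case: ifP.
pose h1 := off h g; pose h2 := off h1 f.
have Ah1 : A *m h1 = 0 by apply: ker_off => //; exact: pos_nonneg.
have Ah2 : A *m h2 = 0 by apply: ker_off => //; [exact: off0|exact: pos_nonneg].
have d1 : ssub (h - h1) g by move=> i gi; rewrite subE offE gi eqxx subrr.
have d2 : ssub (h1 - h2) f by move=> i fi; rewrite subE [h2 i 0]offE fi eqxx subrr.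
have [_ E1] : lev a g != 0 /\ h - h1 = (lev a (h - h1) / lev a g) *: g.
  apply: (svert_ker_line sv) => //; first by rewrite mulmxBr Ah Ah1 subrr.
  by move=> i vi; apply: d1; apply: gv.
have [_ E2] : lev a f != 0 /\ h1 - h2 = (lev a (h1 - h2) / lev a f) *: f.
  apply: (svert_ker_line sw) => //; first by rewrite mulmxBr Ah1 Ah2 subrr.
  by move=> i wi; apply: d2; apply: fw.
have h2g i : g i 0 != 0 -> h2 i 0 = 0.
  by move=> gi; rewrite offE; case: ifP => // _; rewrite offE (negbTE gi).
have h2f i : f i 0 != 0 -> h2 i 0 = 0.
  by move=> fi; rewrite offE (negbTE fi).
have h2v : ssub h2 v.
  move=> i vi; have [fi|/h2f//] := eqVneq (f i 0) 0.
  have wi : w i 0 = 0.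
    have : w i 0 - v i 0 <= f i 0 by rewrite fE le_max lexx.
    by have := w0 i; rewrite fi vi; lra.
  have hi : h i 0 = 0 by apply: hs; rewrite mxE vi wi addr0.
  by rewrite offE; case: ifP => // _; rewrite offE; case: ifP.
(* [h2] is a multiple of [g] but is zero on the support of [g]. *)
have [_ E3] := svert_ker_line sv Ag Ah2 gv h2v gnz.
have h20 : h2 = 0.
  have [i gi] := nonzero_entry gnz.
  have := h2g i gi; rewrite E3 mxE => /eqP; rewrite mulf_eq0 (negbTE gi) orbF => /eqP e.
  by rewrite e scale0r.
exists (lev a (h - h1) / lev a g), (lev a (h1 - h2) / lev a f).
by rewrite -/g -/f -E1 -E2 h20 subr0 subrK.
Qed.

(** Any two distinct vertices are adjacent: a direction [z] combines the two parts of [w - v], which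
    have equal nonzero level, so level 0 forces opposite coefficients. *)
Lemma slice_diam_le1 d : slice_diam A a d -> slice_diam A a 1.
Proof.
move=> [k [M [hM _]]]; exists k, M; split=> // r v w.
move=> /is_vertexE vv /is_vertexE vw; have [->|/eqP nvw] := eqVneq v w; first by left.
right; exists w; split; last by left.
apply/adjacentE; split=> // z /hM[Az lz] zs.
have /hM[Ad ld] := stdpoly_ker vv.1 vw.1.
have sv : svert A a (A *m v) v.
  split; first by split=> //; case: vv => [[]].
  by move=> x Ax lx; case: vv => _; apply; apply/hM.
have sw : svert A a (A *m v) w.
  split; first (split; last by case: vw => [[]]).
    by apply/eqP; rewrite -subr_eq0 -mulmxBr Ad.
  by move=> x Ax lx; case: vw => _; apply; apply/hM.
have lvw : lev a v = lev a w by move: ld; rewrite levB; lra.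
have sp x : ssub x (v + w) -> ssub (pos x) (v + w).
  by move=> xs i e; rewrite mxE xs // maxxx.
have Az' : A *m (- z) = 0 by rewrite mulmxN Az oppr0.
have [c1 [c2 E]] := ker_pos_span sv sw lvw nvw (pos_nonneg z) (ker_pos Az) (sp z zs).
have zs' : ssub (- z) (v + w) by move=> i e; rewrite mxE zs // oppr0.
have [c3 [c4 E']] :=
  ker_pos_span sv sw lvw nvw (pos_nonneg (- z)) (ker_pos Az') (sp _ zs').
have Ag : A *m pos (v - w) = 0.
  by apply: ker_pos; rewrite -opprB mulmxN Ad oppr0.
have gnz := svert_diff_pos sv sw lvw nvw.
have gv : ssub (pos (v - w)) v.
  by move=> i vi; rewrite !mxE vi max_r // sub0r oppr_le0; case: sw => [[_]].
have [lg _] := svert_ker_line sv Ag Ag gv gv gnz.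
have lgf : lev a (pos (w - v)) = lev a (pos (v - w)).
  have : lev a (w - v) = 0 by [].
  by rewrite {1}(posB (w - v)) opprB levB; lra.
have Ez : z = (c1 - c3) *: pos (v - w) + (c2 - c4) *: pos (w - v).
  by rewrite {1}(posB z) E E'; apply: colP0 => i; rewrite !mxE; ring.
have E0 : c2 - c4 = - (c1 - c3).
  move: lz; rewrite {1}Ez levD !levZ lgf -mulrDl => /eqP.
  by rewrite mulf_eq0 (negbTE lg) orbF addrC addr_eq0 => /eqP.
exists (- (c1 - c3)).
rewrite Ez E0 [in RHS](posB (w - v)) [- (w - v)]opprB.
by apply: colP0 => i; rewrite !mxE; ring.
Qed.

End ZeroDiameter.

(** * From pairs back to the 2-sum polyhedron *)

Section TwoSum.
Variables (R : realType) (m1 n1 m2 n2 : nat).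
Variables (A : 'M[R]_(m1, n1)) (a : 'rV[R]_n1) (cA : 'cV[R]_m1).
Variables (B : 'M[R]_(m2, n2)) (b : 'rV[R]_n2) (cB : 'cV[R]_m2) (c : R).
Local Notation P := (twosum A a b B cA cB c).
Local Notation vpair := (vpair A a cA B b cB c).

Definition ker2 (z : 'cV[R]_(n1 + n2)) := [/\ A *m usubmx z = 0, B *m dsubmx z = 0 &
  lev a (usubmx z) + lev b (dsubmx z) = 0].

Lemma nonneg_col_mx (x : 'cV[R]_n1) (y : 'cV[R]_n2) :
  nonneg (col_mx x y) <-> nonneg x /\ nonneg y.
Proof.
split=> [h|[hx hy] i].
  by split=> i; [have := h (lshift _ i); rewrite col_mxEu|
                 have := h (rshift _ i); rewrite col_mxEd].
by rewrite -(splitK i); case: (split i) => j /=; rewrite ?col_mxEu ?col_mxEd.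
Qed.

Lemma ssub_col_mx (x u : 'cV[R]_n1) (y v : 'cV[R]_n2) :
  ssub (col_mx x y) (col_mx u v) <-> ssub x u /\ ssub y v.
Proof.
split=> [h|[hx hy] i].
  by split=> i e; [have := h (lshift _ i); rewrite !col_mxEu|
                 have := h (rshift _ i); rewrite !col_mxEd]; apply.
by rewrite -(splitK i); case: (split i) => j /=; rewrite ?col_mxEu ?col_mxEd; auto.
Qed.

Lemma twosumE x y : P (col_mx x y) <->
  [/\ stdpoly A cA x, stdpoly B cB y & lev a x + lev b y = c].
Proof.
rewrite /twosum /= col_mxKu col_mxKd; split.
  move=> [Ax axy By x0 y0]; split=> //.
  by have := congr1 (fun f : 'M_1 => f 0 0) axy; rewrite mxE [RHS]mxE eqxx.
move=> [[Ax x0] [By y0] l]; split=> //.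
by apply/matrixP => i j; rewrite !ord1 mxE [RHS]mxE eqxx.
Qed.

Lemma ker2E x y : ker2 (col_mx x y) <->
  [/\ A *m x = 0, B *m y = 0 & lev a x + lev b y = 0].
Proof. by rewrite /ker2 col_mxKu col_mxKd. Qed.

Lemma ker2Z t z : ker2 z -> ker2 (t *: z).
Proof.
rewrite -[z]vsubmxK scale_col_mx => /ker2E[h1 h2 h3]; apply/ker2E.
by split; rewrite ?ker_scale // !levZ -mulrDr h3 mulr0.
Qed.

Lemma twosum_nonneg z : P z -> nonneg z.
Proof. by rewrite -[z]vsubmxK => /twosumE[[_ x0] [_ y0] _]; apply/nonneg_col_mx. Qed.

Lemma twosum_move z w : P z -> ker2 w -> nonneg (z + w) -> P (z + w).
Proof.
rewrite -[z]vsubmxK -[w]vsubmxK add_col_mx.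
move=> /twosumE[[Ax _] [By _] l] /ker2E[Au Bv l'] /nonneg_col_mx[h1 h2].
apply/twosumE; split; first by split=> //; rewrite mulmxDr Ax Au addr0.
  by split=> //; rewrite mulmxDr By Bv addr0.
by rewrite !levD; lra.
Qed.

Lemma twosum_diff z w : P z -> P w -> ker2 (w - z).
Proof.
rewrite -[z]vsubmxK -[w]vsubmxK opp_col_mx add_col_mx.
move=> /twosumE[Px Py l] /twosumE[Pu Pv l']; apply/ker2E.
by split; [exact: stdpoly_ker Pu|exact: stdpoly_ker Pv|rewrite !levB; lra].
Qed.

Lemma is_vertex_twosum x y : is_vertex P (col_mx x y) <-> vpair (x, y).
Proof.
rewrite (vertex_kerP ker2Z twosum_nonneg twosum_move twosum_diff) twosumE.
split=> [[[Px Py l] h]|[/= [Px hx] [Py hy] l o]].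
  have h' u v : A *m u = 0 -> B *m v = 0 -> lev a u + lev b v = 0 ->
      ssub u x -> ssub v y -> u = 0 /\ v = 0.
    move=> Au Bv luv us vs.
    have : col_mx u v = 0 by apply: h; [exact/ker2E|exact/ssub_col_mx].
    by rewrite -col_mx0 => /eq_col_mx.
  have s0 k (w : 'cV[R]_k) : ssub 0 w by move=> i _; rewrite mxE.
  have l0 k (w : 'rV[R]_k) : lev w 0 = 0 by rewrite /lev mulmx0 mxE.
  have sx : svert A a cA x.
    split=> // u Au lu us.
    by case: (h' u 0); rewrite ?mulmx0 ?lu ?l0 ?addr0.
  have sy : svert B b cB y.
    split=> // v Bv lv vs.
    by case: (h' 0 v); rewrite ?mulmx0 ?lv ?l0 ?addr0.
  split=> //=; have [vx|nx] := EM (vert A cA x); [by left|right].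
  have [u [unz Au ux]] := not_vert Px nx.
  split=> // v Bv vy; have [lu _] := svert_ker_line sx Au Au ux ux unz.
  (* The weights cancel the total level, so directions at [x] and at [y] cannot both be nonzero. *)
  have [] := h' (lev b v *: u) (- lev a u *: v).
  - exact: ker_scale.
  - exact: ker_scale.
  - by rewrite !levZ; ring.
  - by move=> i xi; rewrite mxE ux // mulr0.
  - by move=> i yi; rewrite mxE vy // mulr0.
  by move=> _ /eqP; rewrite scaler_eq0 oppr_eq0 (negbTE lu) /= => /eqP.
split=> // z; rewrite -[z]vsubmxK.
move: (usubmx z) (dsubmx z) => u v /ker2E[Au Bv luv] /ssub_col_mx[us vs].
have l0 k (w : 'rV[R]_k) : lev w 0 = 0 by rewrite /lev mulmx0 mxE.
case: o => [[_ vx]|[_ vy]].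
  have u0 : u = 0 by apply: vx.
  by rewrite u0 (hy v) ?col_mx0 //; move: luv; rewrite u0 l0 add0r.
have v0 : v = 0 by apply: vy.
by rewrite v0 (hx u) ?col_mx0 //; move: luv; rewrite v0 l0 addr0.
Qed.

Lemma adjacent_twosum x y x1 y1 : adjpair A a cA B b cB c (x, y) (x1, y1) ->
  adjacent P (col_mx x y) (col_mx x1 y1).
Proof.
move=> [v v1 n h].
apply/(adjacent_kerP ker2Z twosum_nonneg twosum_move twosum_diff).
split; [exact/is_vertex_twosum|exact/is_vertex_twosum| |].
  by move=> /eq_col_mx[e1 e2]; apply: n; rewrite e1 e2.
move=> z; rewrite -[z]vsubmxK; move: (usubmx z) (dsubmx z) => u w.
move=> /ker2E[Au Bw l]; rewrite add_col_mx => /ssub_col_mx[us ws].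
have [k [-> ->]] := h u w Au Bw l us ws.
by exists k; rewrite opp_col_mx add_col_mx scale_col_mx.
Qed.

Lemma reach_twosum k x y x1 y1 : reach A a cA B b cB c k (x, y) (x1, y1) ->
  dist_le P k (col_mx x y) (col_mx x1 y1).
Proof.
elim: k x y => [|k IH] x y; first by case=> // -[-> ->]; left.
case=> [[-> ->]|[[u v] [/adjacent_twosum h /IH h']]]; first by left.
by right; exists (col_mx u v).
Qed.

End TwoSum.

(** * Stacked matrices and the final bound *)

Lemma dist_le_mono (R : realType) n (P : pset R n) j k v w :
  (j <= k)%N -> dist_le P j v w -> dist_le P k v w.
Proof.
elim: k j v => [|k IH] [|j] v //=.
- by move=> _ [->|//]; left.
- move=> jk [->|[u [vu uw]]]; first by left.
  by right; exists u; split=> //; apply: IH uw.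
Qed.

Lemma lev_eq0 (R : realType) n (a : 'rV[R]_n) z : lev a z = 0 <-> a *m z = 0.
Proof.
split=> [l|]; last by rewrite /lev => ->; rewrite mxE.
by apply/matrixP => i j; rewrite !ord1 [RHS]mxE.
Qed.

Lemma slice_diam_col_mxu (R : realType) m n (A : 'M[R]_(m, n)) (a : 'rV[R]_n) d :
  mxdiam_le (col_mx A a) d -> slice_diam A a d.
Proof.
move=> h; exists (m + 1)%N, (col_mx A a); split=> // z.
rewrite lev_eq0 mul_col_mx; split=> [|[-> ->]]; last exact: col_mx0.
by rewrite -col_mx0 => /eq_col_mx.
Qed.

Lemma slice_diam_col_mxd (R : realType) m n (A : 'M[R]_(m, n)) (a : 'rV[R]_n) d :
  mxdiam_le (col_mx a A) d -> slice_diam A a d.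
Proof.
move=> h; exists (1 + m)%N, (col_mx a A); split=> // z.
rewrite lev_eq0 mul_col_mx; split=> [|[-> ->]]; last exact: col_mx0.
by rewrite -col_mx0 => /eq_col_mx[].
Qed.

(* When [A] has diameter [0], the coefficient of the slice diameter in the bound
   vanishes, so that the slice diameter may be replaced by [1]. *)
Lemma slice_diam_normalize (R : realType) m n (A : 'M[R]_(m, n)) (a : 'rV[R]_n) d e :
  mxdiam_le A d -> slice_diam A a e -> exists f,
  [/\ slice_diam A a f, (d = 0 -> f <= 1)%N & (d * (f + 1) = d * (e + 1))%N].
Proof.
case: d => [|d] hA he; last by exists e.
by exists 1%N; split=> //; exact: slice_diam_le1 he.
Qed.

Theorem theorem1 (R : realType) (m1 n1 m2 n2 : nat)
  (A : 'M[R]_(m1, n1)) (a : 'rV[R]_n1) (b : 'rV[R]_n2) (B : 'M[R]_(m2, n2))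
  (cA : 'cV[R]_m1) (cB : 'cV[R]_m2) (c : R)
  (dA dAbar dB dBbar : nat) :
  a != 0 -> b != 0 ->
  mxdiam_le A dA -> mxdiam_le (col_mx A a) dAbar ->
  mxdiam_le B dB -> mxdiam_le (col_mx b B) dBbar ->
  diam_le (twosum A a b B cA cB c)
    (dA * (dAbar + 1) + dB * (dBbar + 1)
     + minn (dAbar + dB + 1) (dA + dBbar + 1))%N.
Proof.
move=> _ _ hA /slice_diam_col_mxu ha hB /slice_diam_col_mxd hb.
have [da [ha' da1 Ea]] := slice_diam_normalize hA ha.
have [db [hb' db1 Eb]] := slice_diam_normalize hB hb.
move=> v w; rewrite -[v]vsubmxK -[w]vsubmxK.
move=> /is_vertex_twosum v1 /is_vertex_twosum v2.
(* [pair_diam] leaves [+ 1] beyond the two products, and both terms of the minimum are at least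
   1. *)
apply: dist_le_mono (reach_twosum (pair_diam hA hB ha' hb' da1 db1 v1 v2)).
by rewrite Ea Eb leq_add2l leq_min !addn1.
Qed.
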